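(* Consider a budgeted causal bandit instance on a no-backdoor graph with $M$ binary intervenable nodes, intervention cost $\gamma\ge 1$, and $p=\min_{i,x}p_{i,x}>0$, where $p_{i,x}=\mathbb{P}(X_i=x)$. Let $v_{i,x}=\mu_{i,x}/\gamma$, $v_0=\mu_0$, $a^*=\arg\max_{a\in\mathcal{A}}v_a$, and for $a\in\mathcal{A}$ let $\Delta_a=\mu_{a^*}-\mu_a$ and $d_a=v_{a^*}-v_a$ (with indices $i,x$ for $a=a_{i,x}$ and index $0$ for $a=a_0$; some $\Delta_a$ may be negative). Consider the algorithm CRM-NB-ALG (defined in the context) with budget $B$. (i) If $a^*=a_0$, then the expected cumulative regret of the algorithm is $O(1)$. (ii) Otherwise, the expected cumulative regret of the algorithm is of order $$\sum_{(i,x):\,\Delta_{i,x}>0} \Delta_{i,x}\left(\max\left(0,\, 1+ 8\ln B\left(\frac{1}{d_{i,x}^2} - \frac{p_{i,x}}{3d_0^2}\right) \right) + \frac{\pi^2}{3}\right) + \Delta_0 \left(\frac{50\ln B}{d_{0}^2} + 1 + \frac{\pi^2}{3} \right).$$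
   Context: Setting. A causal Bayesian network is a directed acyclic graph $\mathcal{G}$ whose nodes are random variables with finite ranges, together with a joint distribution $\mathbb{P}$ factorizing over $\mathcal{G}$. The intervention $do(X=x)$ removes all edges from the parents of $X$ into $X$ and sets $X=x$; the empty intervention $do()$ (observation) samples from $\mathbb{P}$. There is a reward node $Y\in\{0,1\}$ and a set of intervenable nodes $X_1,\dots,X_M\in\{0,1\}$; when not intervened upon, $X_i\sim\mathrm{Bernoulli}(p_i)$, with $p_{i,1}=p_i$, $p_{i,0}=1-p_i$. The graph is a no-backdoor graph: there are no backdoor paths from any $X_i$ to $Y$, so that $E[Y\mid do(X_i=x)]=E[Y\mid X_i=x]$. Arms. $\mathcal{A}=\{a_{i,x}: i\in[M],x\in\{0,1\}\}\cup\{a_0\}$, where $a_{i,x}=do(X_i=x)$ has mean reward $\mu_{i,x}=E[Y\mid X_i=x]$, and $a_0=do()$ has mean reward $\mu_0=E[Y]$. Pulling $a_0$ costs $1$ and reveals an independent sample of the variables (in particular $X_1,\dots,X_M,Y$); pulling $a_{i,x}$ costs $\gamma$ and yields a reward sampled from the intervened distribution. The total cost may not exceed the budget $B$. The algorithm does not know $\mathbb{P}$. If $\max_{i,x}\mu_{i,x}\le\gamma\mu_0$ then $a^*=a_0$ (so a tie between $a_0$ and an intervention is resolved in favour of $a_0$). Cumulative regret. If $G_{\mathtt{ALG}}(B)$ is the expected total reward accumulated by algorithm $\mathtt{ALG}$ with budget $B$ and $G_B=\max_{\mathtt{ALG}}G_{\mathtt{ALG}}(B)$, the (expected) cumulative regret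 of $\mathtt{ALG}$ is $G_B-G_{\mathtt{ALG}}(B)$. Quantities used by the algorithm. $a_s,Y_s$ are the arm and reward of round $s$. $N^a_t$ is the number of pulls of arm $a$ in the first $t$ rounds ($N^0_t$ for $a_0$, $N^{i,x}_t$ for $a_{i,x}$); $E^{i,x}_t=N^{i,x}_t+\sum_{s=1}^t\mathbb{1}\{a_s=a_0\text{ and }X_i=x\text{ in round }s\}$. $\widehat\mu_{i,x}(t)$ is the average of $Y_s$ over the $E^{i,x}_t$ rounds $s\le t$ in which $a_s=a_{i,x}$, or $a_s=a_0$ and $X_i=x$; $\widehat\mu_0(t)$ is the average of $Y_s$ over the rounds $s\le t$ with $a_s=a_0$. Further $$\overline{\mu}_{i,x}(t)=\frac1\gamma\left(\widehat\mu_{i,x}(t)+\sqrt{\frac{8\log t}{E^{i,x}_t}}\right),\qquad \overline\mu_0(t)=\widehat\mu_0(t)+\sqrt{\frac{8\log t}{N^0_t}}.$$ Algorithm CRM-NB-ALG. Pull each of the $2M+1$ arms once; set $\beta=1$, $t=2M+2$, and remaining budget $B_t=B-2\gamma M-1$. While $B_t\ge1$: (a) if $N^0_{t-1}<\beta^2\log t$ or $B_t<\gamma$, pull $a_t=a_0$; otherwise pull $a_t\in\arg\max_{a\in\mathcal{A}}\overline\mu_a(t-1)$; (b) update all counts and estimates to time $t$; (c) let $\widehat\mu^*=\max_{i,x}\widehat\mu_{i,x}(t)$; if $\widehat\mu_0(t)<\widehat\mu^*/\gamma$, set $\beta=\min\left(\frac{2\sqrt2}{\widehat\mu^*/\gamma-\widehat\mu_0(t)},\sqrt{\log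 t}\right)$ (otherwise $\beta$ is unchanged); (d) set $B_{t+1}=B_t-1$ if $a_t=a_0$ and $B_{t+1}=B_t-\gamma$ otherwise, and increase $t$ by $1$. Logarithms are natural. *)

(* Defs.v *)
From mathcomp Require Import all_boot all_order all_algebra.
From mathcomp Require Import boolp classical_sets reals exp trigo.

Set Implicit Arguments.
Unset Strict Implicit.
Unset Printing Implicit Defensive.

Import Order.TTheory GRing.Theory Num.Theory.
Local Open Scope ring_scope.

(* Node v takes its values in {0, ..., range_size v - 1}; cpt v y w is
   P(v = y | parents of v as in w), so it may only read w on the parents. *)
Record causal_network (R : realType) := CausalNetwork {
  node : finType;
  edge : rel node;
  edge_acyclic : forall (v : node) (s : seq node),
    s != [::] -> path edge v s -> last v s != v;
  range_size : node -> nat;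
  range_size_gt0 : forall v, (0 < range_size v)%N;
  cpt : forall v : node,
    'I_(range_size v) -> {dffun forall u : node, 'I_(range_size u)} -> R;
  cpt_ge0 : forall v y w, 0 <= @cpt v y w;
  cpt_sum1 : forall v w, \sum_(y < range_size v) @cpt v y w = 1;
  cpt_local : forall v y (w w' : {dffun forall u : node, 'I_(range_size u)}),
    (forall u, edge u v -> w u = w' u) -> @cpt v y w = @cpt v y w'
}.

Arguments edge {R} _ _ _.
Arguments range_size {R} _ _.
Arguments cpt {R} _ _ _ _.

Notation assignment G := {dffun forall v : node G, 'I_(range_size G v)}.

(* x :: s is a path without repeated nodes in the undirected skeleton, from x
   to y, whose first edge points into x. *)
Definition backdoor_path (R : realType) (G : causal_network R) (x y : node G)
    (s : seq (node G)) : bool :=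
  [&& path (fun u v => edge G u v || edge G v u) x s,
      uniq (x :: s),
      last x s == y
    & if s is u :: _ then edge G u x else false].

(* No bound is imposed on the intervention cost gamma here. *)
Record causal_bandit (R : realType) := CausalBandit {
  network : causal_network R;
  M : nat;
  M_gt0 : (0 < M)%N;
  X : 'I_M -> node network;
  X_inj : injective X;
  Y : node network;
  X_neq_Y : forall i, X i != Y;
  X_binary : forall i, range_size network (X i) = 2%N;
  Y_binary : range_size network Y = 2%N;
  gamma : R
}.

Arguments X {R} _ _.
Arguments Y {R} _.
Arguments gamma {R} _.

Section Bandit.
Context (R : realType) (I : causal_bandit R).

Let G := network I.
Let m := M I.

Definition no_backdoor : Prop :=
  forall i (s : seq (node G)), ~~ backdoor_path (X I i) (Y I) s.

(* None is the observational arm do(); Some (i, x) is do(X_i = x), the values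
   1 and 0 of X_i being coded by true and false. *)
Definition arm : Type := option ('I_m * bool).

Definition obs_arm : arm := None.
Definition do_arm (i : 'I_m) (x : bool) : arm := Some (i, x).

Definition cost (a : arm) : R := if a is Some _ then gamma I else 1.

Definition value_is (w : assignment G) (i : 'I_m) (x : bool) : bool :=
  (w (X I i) : nat) == (x : nat).

Definition reward (w : assignment G) : nat := w (Y I).

(* Joint law of all the variables under the intervention a (truncated
   factorization); the observational law is arm_law obs_arm. *)
Definition arm_law (a : arm) (w : assignment G) : R :=
  \prod_(v : node G)
    match a with
    | Some (i, x) => if v == X I i then (value_is w i x)%:R
                     else cpt G v (w v) w
    | None => cpt G v (w v) w
    end.

Definition prob (i : 'I_m) (x : bool) : R :=
  \sum_(w | value_is w i x) arm_law obs_arm w.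

(* The neutral element 1 is harmless, as every prob i x is at most 1. *)
Definition prob_min : R :=
  \big[Num.min/1]_(ix : 'I_m * bool) prob ix.1 ix.2.

(* E[Y] for obs_arm, and the conditional mean E[Y | X_i = x] for do(X_i = x). *)
Definition mu (a : arm) : R :=
  match a with
  | None => \sum_w arm_law obs_arm w * (reward w)%:R
  | Some (i, x) =>
      (\sum_(w | value_is w i x) arm_law obs_arm w * (reward w)%:R) / prob i x
  end.

Definition value (a : arm) : R := mu a / cost a.

Definition best_arm (a : arm) : Prop :=
  (forall b, value b <= value a) /\
  ((forall b, value b <= value obs_arm) -> a = obs_arm).

Definition mean_gap (astar a : arm) : R := mu astar - mu a.
Definition value_gap (astar a : arm) : R := value astar - value a.

(* What the learner sees in one round: the arm, the whole sample when the arm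
   is obs_arm, and the reward. Histories list the latest round first. *)
Definition round : Type := (arm * option (assignment G) * nat)%type.
Definition history : Type := seq round.

Definition observe (a : arm) (w : assignment G) : round :=
  (a, if a is None then Some w else None, reward w).

(* The answer None means that the algorithm stops. *)
Definition algorithm : Type := history -> option arm.

(* Expected reward collected from history h on with remaining budget b, during
   at most n further rounds; a pull that is not affordable ends the run. *)
Fixpoint reward_to_go (alg : algorithm) (n : nat) (h : history) (b : R) : R :=
  if n is n'.+1 then
    if alg h is Some a then
      if cost a <= b then
        \sum_w arm_law a w *
          ((reward w)%:R +
           reward_to_go alg n' (observe a w :: h) (b - cost a))
      else 0
    else 0
  else 0.

(* When gamma >= 1 every round costs at least 1, so a budget B allows at most
   floor(B) rounds and the horizon is no restriction. *)
Definition expected_reward (alg : algorithm) (B : R) : R :=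
  reward_to_go alg (Num.truncn B) [::] B.

Definition optimal_reward (B : R) : R :=
  sup [set expected_reward alg B | alg in [set: algorithm]]%classic.

Definition regret (alg : algorithm) (B : R) : R :=
  optimal_reward B - expected_reward alg B.

Definition spent (h : history) : R := \sum_(r <- h) cost r.1.1.

Definition pulls (a : arm) (h : history) : nat :=
  count (fun r : round => r.1.1 == a) h.

(* The rounds used to estimate the mean of arm a; for do(X_i = x) these include
   the observational rounds in which X_i = x. *)
Definition informative (a : arm) (r : round) : bool :=
  (r.1.1 == a) ||
  match a, r with
  | Some (i, x), (None, Some w, _) => value_is w i x
  | _, _ => false
  end.

Definition samples (a : arm) (h : history) : nat := count (informative a) h.

Definition mu_hat (a : arm) (h : history) : R :=
  (\sum_(r <- h | informative a r) r.2%:R) / (samples a h)%:R.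

Definition mu_hat_max (h : history) : R :=
  \big[Num.max/0]_(ix : 'I_m * bool) mu_hat (do_arm ix.1 ix.2) h.

(* size h is the round t up to which the estimates are taken. *)
Definition ucb (a : arm) (h : history) : R :=
  (mu_hat a h + Num.sqrt (8 * ln (size h)%:R / (samples a h)%:R)) / cost a.

Definition init_rounds : nat := (2 * m + 1)%N.

Fixpoint beta (h : history) : R :=
  if h is _ :: h' then
    if (size h <= init_rounds)%N then 1
    else if mu_hat obs_arm h < mu_hat_max h / gamma I then
      Num.min (2 * Num.sqrt 2 / (mu_hat_max h / gamma I - mu_hat obs_arm h))
              (Num.sqrt (ln (size h)%:R))
    else beta h'
  else 1.

(* Decisions o allowed after history h, that is in round (size h).+1: the order
   of the initial pulls and the choice among maximizers are left free. *)
Definition crm_nb_decision (B : R) (h : history) (o : option arm) : Prop :=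
  let remaining := B - spent h in
  if (size h < init_rounds)%N then
    exists2 a, o = Some a & pulls a h = 0%N
  else if remaining < 1 then o = None
  else if ((pulls obs_arm h)%:R < beta h ^+ 2 * ln (size h).+1%:R)
          || (remaining < gamma I) then o = Some obs_arm
  else exists2 a, o = Some a & forall b, ucb b h <= ucb a h.

Definition crm_nb_alg (B : R) (alg : algorithm) : Prop :=
  forall h, crm_nb_decision B h (alg h).

Definition regret_bound (astar : arm) (B : R) : R :=
  let d0 := value_gap astar obs_arm in
  \sum_(ix : 'I_m * bool | 0 < mean_gap astar (do_arm ix.1 ix.2))
     (let a := do_arm ix.1 ix.2 in
      mean_gap astar a *
      (Num.max 0 (1 + 8 * ln B *
         (1 / value_gap astar a ^+ 2 - prob ix.1 ix.2 / (3 * d0 ^+ 2)))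
       + pi ^+ 2 / 3))
  + mean_gap astar obs_arm * (50 * ln B / d0 ^+ 2 + 1 + pi ^+ 2 / 3).

End Bandit.

Arguments obs_arm {R I}.

(* Main.v *)
(** Measured against the best value per unit cost, a round loses cost times value
    gap, so the regret is at most a constant plus a combination of the expected
    numbers of pulls. A pull that is not forced means that the index of the arm is
    at least that of the best arm, so that the arm has few samples or some estimate
    deviates. Deviations are handled by exponential supermartingales and Ville's
    inequality, indexed by the number of samples instead of time; their
    probabilities are then summable although beta adapts to the data.

    If an intervention is best, then, with probability close to 1, after an
    instance-dependent time the empirical gap stays close to d0. From then on
    beta is close to 2 sqrt 2 / d0, so about 8 ln t / d0^2 observations have
    been made, and a share close to p_{i,x} of them are samples of a_{i,x}; this
    is the negative term of the bound. All error terms are a small multiple of ln B,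
    absorbed by the term of the observational arm.

    If observing is best, possibly with ties, then comparing indices shows that
    the samples of each intervention pulled are at most a fixed multiple of the
    observations. The observations are therefore linear in t and, as a positive
    share of them informs about any given intervention, a late pull of an inferior
    one requires an exponentially unlikely deviation.

    The law of the reward under do(X_i = x) is compared with the conditional law by
    exchanging, between two independent samples of the intervened network, the
    coordinates connected to the parents of X_i in the skeleton without X_i. *)

Require Import Defs.
From mathcomp Require Import all_boot all_order all_algebra.
From mathcomp Require Import classical_sets reals topology normedtype.
From mathcomp Require Import sequences derive realfun exp trigo.
From mathcomp Require Import ring lra zify.

Set Implicit Arguments.
Unset Strict Implicit.
Unset Printing Implicit Defensive.

Import Order.TTheory GRing.Theory Num.Theory.
Import numFieldNormedType.Exports.
Local Open Scope ring_scope.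

(** * Concentration of Bernoulli variables *)

(** Multiplied by exp (- x^2 / 2), the centred moment generating function is non-increasing for x >=
    0: its derivative is a negative multiple of q x e^x + (1 - q) x - q (1 - q) (e^x - 1), which is
    non-negative because e^x - 1 <= x e^x. The constant 1/2 replaces Hoeffding's 1/8. *)
Lemma bernoulli_mgf_ge0 (R : realType) (q l : R) : 0 <= q <= 1 -> 0 <= l ->
  q * expR (l * (1 - q)) + (1 - q) * expR (- (l * q)) <= expR (l ^+ 2 / 2).
Proof.
move=> /andP[q0 q1] l0.
pose g (a x : R) := x * a - x ^+ 2 / 2.
have dg a (x : R) : is_derive x 1 (fun y => expR (g a y)) ((a - x) * expR (g a x)).
  have dg' : is_derive x 1 (g a) (a - x).
    rewrite /g; apply: is_derive_eq.
    by rewrite /GRing.scale /=; field.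
  by rewrite mulrC; exact: (is_derive1_comp (is_derive_expR _) dg').
pose f (x : R) := q * expR (g (1 - q) x) + (1 - q) * expR (g (- q) x).
have df (x : R) : is_derive x 1 f
   (q * ((1 - q - x) * expR (g (1 - q) x)) +
    (1 - q) * ((- q - x) * expR (g (- q) x))).
  by apply: is_deriveD; apply: is_deriveZ.
have cd : continuous f.
  by move=> x; apply/differentiable_continuous/derivable1_diffP; exact: ex_derive.
have [c /[!in_itv]/= /andP[c0 cl]] := MVT_segment l0 (fun x _ => df x) (continuous_subspaceT cd).
rewrite subr0 => fE.
have gE x : expR (g (1 - q) x) = expR x * expR (g (- q) x).
  by rewrite -expRD; congr expR; rewrite /g; ring.
have le0 : f l - f 0 <= 0.
  rewrite fE mulr_le0_ge0 // gE.
  set u := expR _; set v := expR (g _ _).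
  have v0 : 0 < v := expR_gt0 _.
  have -> : q * ((1 - q - c) * (u * v)) + (1 - q) * ((- q - c) * v) =
    - v * (q * c * u + (1 - q) * c - q * (1 - q) * (u - 1)) by ring.
  rewrite mulNr oppr_le0; apply: mulr_ge0; first exact: ltW.
  rewrite subr_ge0.
  have u1 : u - 1 <= c * u.
    have := expR_ge1Dx (- c); rewrite expRN -/u => h.
    have u0 : 0 < u := expR_gt0 _.
    by have := ler_wpM2l (ltW u0) h; rewrite mulfV ?gt_eqF //; lra.
  have {}u1 : q * (u - 1) * (1 - q) <= q * (c * u).
    have cu : 0 <= c * u by rewrite mulr_ge0 // ltW // expR_gt0.
    have u10 : 0 <= u - 1 by have := expR_ge1Dx c; rewrite -/u; lra.
    rewrite -mulrA ler_wpM2l //; nra.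
  nra.
move: le0; rewrite /f /g !mul0r expr0n /= mul0r subr0 expR0 !mulr1 subr_le0.
rewrite !expRB mulrN -/(_ / _).
set a := expR (l * _); set b := expR (- _); set d := expR _.
have d0 : 0 < d := expR_gt0 _.
move=> h; have := ler_wpM2r (ltW d0) h.
rewrite mulrDl -!mulrA !mulVf ?gt_eqF //; lra.
Qed.

(** * Truncated factorizations and the no-backdoor identity *)

Section Network.
Context (R : realType) (G : causal_network R).

Definition ancestors (v : node G) := [set u | connect (edge G) u v].

(** The number of ancestors serves as a topological rank: by acyclicity v is an ancestor of itself
    but not of its parent u. *)
Lemma edge_ancestors (u v : node G) :
  edge G u v -> (#|ancestors u| < #|ancestors v|)%N.
Proof.
move=> uv; apply: proper_card; apply/properP; split.
  apply/fintype.subsetP => w; rewrite !inE => wu.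
  exact: connect_trans wu (connect1 uv).
exists v; rewrite !inE ?connect0 //.
apply/negP => /connectP[s ps lu].
have /negP[] : last v (rcons s v) != v.
  by apply: edge_acyclic; [case: (s)|rewrite rcons_path ps -lu uv].
by rewrite last_rcons.
Qed.

Lemma source_exists (S : {set node G}) (v0 : node G) : v0 \in S ->
  exists2 s, s \in S & forall u, edge G u s -> u \notin S.
Proof.
move=> v0S; case: (@arg_minnP _ v0 [in S] (fun v => #|ancestors v|) v0S) => s sS mins.
exists s => // u us; apply/negP => uS.
by have := edge_ancestors us; rewrite ltnNge mins.
Qed.

(* The factors f need not come from cpt: this also covers truncated
   factorizations. *)
Definition kernels (f : forall v : node G, 'I_(range_size G v) -> assignment G -> R) :=
  (forall v w, \sum_y f v y w = 1) /\
  (forall v y (w w' : assignment G),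
     (forall u, edge G u v -> w u = w' u) -> f v y w = f v y w').

Definition update (w : assignment G) (s : node G) (y : 'I_(range_size G s)) : assignment G :=
  [ffun v => dfwith w y v].

(** Induction on the set S of nodes that are still free, the others being frozen at [w0]. The factor
    of a source of S reads only frozen nodes, so it leaves the sum over the rest, which is 1 by
    induction. *)
Lemma kernels_sum1 f : kernels f ->
  \sum_(w : assignment G) \prod_v f v (w v) w = 1.
Proof.
case=> f1 floc.
suff H (n : nat) (S : {set node G}) (w0 : assignment G) : #|S| = n ->
    \sum_(w : assignment G | [forall v, (v \notin S) ==> (w v == w0 v)])
      \prod_(v in S) f v (w v) w = 1.
  have w0 : assignment G := [ffun v => Ordinal (range_size_gt0 v)].
  rewrite -[RHS](H _ [set: node G] w0 erefl); apply: eq_big => w.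
    by apply/esym/forallP => v; rewrite !inE.
  by move=> _; apply: eq_bigl => v; rewrite !inE.
elim: n S w0 => [|n IH] S w0 Sn.
  rewrite (cards0_eq Sn) (big_pred1 w0) ?big_set0 // => w.
  apply/forallP/eqP => [h|-> v]; last by rewrite eqxx implybT.
  by apply/ffunP => v; apply/eqP; have := h v; rewrite !inE.
have /card_gt0P[v0 v0S] : (0 < #|S|)%N by rewrite Sn.
have [s sS srcs] := source_exists v0S.
have Sn' : #|S :\ s| = n by move: Sn; rewrite (cardsD1 s) sS => -[].
rewrite (partition_big (fun w : assignment G => w s) predT) //=.
rewrite -[RHS](f1 s w0); apply: eq_bigr => y _.
rewrite -[RHS]mulr1 -[X in _ = _ * X](IH _ (update w0 y) Sn') mulr_sumr.
apply: eq_big => w.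
  apply/andP/forallP => [[/forallP h /eqP wy] v|h].
    rewrite !inE negb_and negbK /update ffunE; case: dfwithP => [|v' sv].
      by rewrite wy !eqxx implybT.
    by rewrite eq_sym (negPf sv) /=; exact: h.
  split; last by have := h s; rewrite !inE eqxx /= /update ffunE dfwith_in.
  apply/forallP => v; apply/implyP => vS; have := h v.
  rewrite !inE negb_and negbK vS orbT /= /update ffunE dfwith_out //.
  by apply: contraNneq vS => <-.
move=> /andP[/forallP h /eqP wy].
rewrite (bigD1 s) //= wy; congr (_ * _).
  apply: floc => u us; apply/eqP; exact: (implyP (h u) (srcs u us)).
by apply: eq_bigl => v; rewrite !inE andbC.
Qed.

End Network.

(** * Intervened law and conditional law *)

Section DoCalculus.
Context (R : realType) (I : causal_bandit R).
Local Notation G := (network I).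

Lemma value_is_lt (i : 'I_(M I)) (x : bool) : (x < range_size G (X I i))%N.
Proof. by rewrite X_binary; case: x. Qed.

Definition value_ord (i : 'I_(M I)) (x : bool) : 'I_(range_size G (X I i)) :=
  Ordinal (value_is_lt i x).

Lemma value_isP (w : assignment G) i x : reflect (w (X I i) = value_ord i x) (value_is w i x).
Proof. by apply: (iffP eqP) => [h|->] //; apply: val_inj. Qed.

(** The value of the node is a separate argument, so that the truncated factors form [kernels]. *)
Definition arm_factor (a : arm I) (v : node G) (y : 'I_(range_size G v)) (w : assignment G) : R :=
  match a with
  | Some (i, x) => if v == X I i then ((y : nat) == (x : nat))%:R else cpt G v y w
  | None => cpt G v y w
  end.

Lemma arm_lawE a (w : assignment G) : arm_law a w = \prod_v arm_factor a (w v) w.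
Proof.
apply: eq_bigr => v _; case: a => [[i x]|] //=; case: eqP => // e.
by rewrite /value_is -[in LHS]e.
Qed.

Lemma arm_law_ge0 a (w : assignment G) : 0 <= arm_law a w.
Proof.
rewrite arm_lawE; apply: prodr_ge0 => v _.
by case: a => [[i x]|] /=; [case: ifP => _; rewrite ?ler0n|]; rewrite ?cpt_ge0.
Qed.

Lemma arm_law_sum1 a : \sum_(w : assignment G) arm_law a w = 1.
Proof.
under eq_bigr do rewrite arm_lawE; apply: kernels_sum1.
split=> [v w|v y w w' h]; case: a => [[i x]|] /=; try exact: cpt_sum1; try exact: cpt_local.
  have [->|_] := eqVneq v (X I i); last exact: cpt_sum1.
  rewrite (bigD1 (value_ord i x)) //= eqxx big1 ?addr0 // => y.
  by rewrite -val_eqE /= => /negPf ->.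
by case: ifP => // _; exact: cpt_local.
Qed.

Variables (i : 'I_(M I)) (x : bool).
Hypothesis nobd : no_backdoor I.

Let Xi := X I i.
Let D (w : assignment G) := arm_law (Some (i, x) : arm I) w.

(* Edges of the skeleton with X_i removed. A below is the union of the
   components of the parents of X_i; without a backdoor path it misses Y. *)
Let avoid (u v : node G) :=
  [&& edge G u v || edge G v u, u != Xi & v != Xi].

Let A := [set v | [exists u, edge G u Xi && connect avoid u v]].

Let edge_irr (v : node G) : ~~ edge G v v.
Proof.
apply/negP => vv; have /negP[] : last v [:: v] != v.
  by apply: edge_acyclic => //=; rewrite vv.
by [].
Qed.

Let parent_A u : edge G u Xi -> u \in A.
Proof. by move=> uX; rewrite inE; apply/existsP; exists u; rewrite uX connect0. Qed.

Let avoid_path_notin u s : u != Xi -> path avoid u s -> Xi \notin u :: s.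
Proof.
elim: s u => [|v s IH] u uX /=; first by rewrite inE eq_sym.
by case/andP=> /and3P[_ _ vX] /(IH _ vX); rewrite (in_cons u) negb_or eq_sym uX.
Qed.

Let parent_neq u : edge G u Xi -> u != Xi.
Proof. by move=> uX; apply: contraTneq uX => ->; exact: edge_irr. Qed.

Let X_notin_A : Xi \notin A.
Proof.
rewrite inE; apply/existsP => -[u /andP[uX /connectP[s ps lX]]].
have := avoid_path_notin (parent_neq uX) ps.
by rewrite lX mem_last.
Qed.

Let Y_notin_A : Y I \notin A.
Proof.
rewrite inE; apply/existsP => -[u /andP[uX /connectP[s ps lY]]].
have [s' ps' [us' lY']] : exists2 s', path avoid u s' & uniq (u :: s') /\ last u s' = last u s.
  by case/shortenP: ps => s' ? ? _; exists s'.
have := nobd i (u :: s'); rewrite /backdoor_path /= uX orbT lY' -lY eqxx !andbT /=.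
have -> /= : path (fun a b => edge G a b || edge G b a) u s'.
  by apply: sub_path ps' => a b /and3P[].
move: us' => /= ->; rewrite andbT => /negP[].
exact: avoid_path_notin (parent_neq uX) ps'.
Qed.

Let A_closed u v : edge G u v -> u != Xi -> v != Xi -> (u \in A) = (v \in A).
Proof.
move=> uv uX vX; rewrite !inE; apply/existsP/existsP => -[t /andP[tX tc]];
  exists t; rewrite tX /=; apply: connect_trans tc (connect1 _).
  by rewrite /avoid uv uX vX.
by rewrite /avoid uv orbT uX vX.
Qed.

Let mix (w w' : assignment G) : assignment G := [ffun v => if v \in A then w v else w' v].

(* Once X_i is fixed, no factor links A to its complement, so two independent
   samples may exchange their coordinates in A. *)
Let D_mix (w w' : assignment G) : value_is w i x -> value_is w' i x ->
  D w * D w' = D (mix w w') * D (mix w' w).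
Proof.
move=> /value_isP wx /value_isP wx'.
rewrite /D !arm_lawE -!big_split /=; apply: eq_bigr => v _.
have [->|vX] := eqVneq v (X I i).
  by rewrite /mix !ffunE (negPf X_notin_A) wx wx' mulrC.
have mixE (w1 w2 : assignment G) u : edge G u v -> w1 (X I i) = w2 (X I i) ->
    (mix w1 w2) u = (if v \in A then w1 else w2) u.
  move=> uv wX; rewrite ffunE; have [->|uX] := eqVneq u (X I i).
    by case: ifP; case: ifP.
  by rewrite (A_closed uv uX vX); case: ifP.
have wX : w (X I i) = w' (X I i) by rewrite wx wx'.
have m1 : cpt G v (mix w w' v) (mix w w') =
    cpt G v ((if v \in A then w else w') v) (if v \in A then w else w').
  rewrite ffunE; case: ifP => vA; apply: cpt_local => u uv;
    by rewrite mixE ?vA.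
have m2 : cpt G v (mix w' w v) (mix w' w) =
    cpt G v ((if v \in A then w' else w) v) (if v \in A then w' else w).
  rewrite ffunE; case: ifP => vA; apply: cpt_local => u uv;
    by rewrite mixE ?vA.
by rewrite m1 m2; case: ifP => _; rewrite // mulrC.
Qed.

Let D_eq0 (w : assignment G) : ~~ value_is w i x -> D w = 0.
Proof.
rewrite /value_is => /negPf wx; rewrite /D arm_lawE (bigD1 (X I i)) //= eqxx wx.
by rewrite mul0r.
Qed.

Let swap (ww : assignment G * assignment G) := (mix ww.1 ww.2, mix ww.2 ww.1).

Let swapK : involutive swap.
Proof.
by case=> w w'; congr pair; apply/ffunP => v; rewrite /= !ffunE; case: (v \in A).
Qed.

Let g (w : assignment G) := cpt G Xi (value_ord i x) w.

(** The left side is multiplied by the total mass of a second, independent sample. After the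
    exchange of the coordinates in [A], the parents of X_i are read off one sample and Y off the
    other. *)
Let D_indep : \sum_w D w * (g w * (reward w)%:R) =
  (\sum_w D w * g w) * (\sum_w D w * (reward w)%:R).
Proof.
rewrite -[LHS]mulr1 -[X in _ * X = _](arm_law_sum1 (Some (i, x) : arm I)) !big_distrlr /= !pair_big /=.
rewrite [RHS](reindex_inj (inv_inj swapK)) /=; apply: eq_bigr => -[w w'] _ /=.
have rE : reward (mix w' w) = reward w by rewrite /reward /mix ffunE (negPf Y_notin_A).
have gE : g (mix w w') = g w.
  by apply: cpt_local => u /parent_A uA; rewrite ffunE uA.
rewrite rE gE.
have mX w1 w2 : value_is (mix w1 w2) i x = value_is w2 i x.
  by rewrite /value_is ffunE (negPf X_notin_A).
have [wx|wx] := boolP (value_is w i x); last first.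
  by rewrite (D_eq0 wx) (@D_eq0 (mix w' w)) ?mX // !mul0r mulr0.
have [wx'|wx'] := boolP (value_is w' i x); last first.
  by rewrite -/(D w') (D_eq0 wx') (@D_eq0 (mix w w')) ?mX // !mul0r mulr0.
have := D_mix wx wx'; rewrite -/(D w').
set a := D (mix w w'); set b := D (mix w' w) => h.
transitivity (D w * D w' * (g w * (reward w)%:R)); first by rewrite /D; ring.
by rewrite h; ring.
Qed.

(** On the event X_i = x the observational law is the intervened law reweighted by the factor [g] of
    X_i. *)
Let obs_D (f : assignment G -> R) :
  \sum_(w | value_is w i x) arm_law (obs_arm : arm I) w * f w = \sum_w D w * (g w * f w).
Proof.
rewrite [RHS](bigID (fun w => value_is w i x)) /= [X in _ = _ + X]big1 ?addr0; last first.
  by move=> w /D_eq0 ->; rewrite mul0r.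
apply: eq_bigr => w wx; rewrite mulrA; congr (_ * _).
rewrite /D !arm_lawE (bigD1 (X I i)) //= [in RHS](bigD1 (X I i)) //= eqxx.
have /value_isP wx' := wx; rewrite wx' eqxx mul1r mulrC /g; congr (_ * _).
by apply: eq_bigr => v /negPf ->.
Qed.

(** As [g] and the reward are uncorrelated under the intervention, the mean of [g] cancels between
    the numerator and the denominator of the conditional mean. *)
Lemma mu_doE : 0 < prob i x ->
  \sum_w arm_law (do_arm i x) w * (reward w)%:R = mu (do_arm i x).
Proof.
move=> p0; rewrite /= -[RHS]/(_ / _); apply: (mulIf (lt0r_neq0 p0)).
rewrite divfK ?lt0r_neq0 // obs_D D_indep mulrC; congr (_ * _).
transitivity (\sum_(w | value_is w i x) arm_law (obs_arm : arm I) w * 1).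
  by apply: eq_bigr => w _; rewrite mulr1.
by rewrite obs_D; under eq_bigr do rewrite mulr1.
Qed.

End DoCalculus.

(** * The law of the history *)

Section Process.
Context (R : realType) (I : causal_bandit R) (alg : algorithm I) (B : R).
Local Notation G := (network I).
Implicit Types (f V : history I -> R) (h g : history I) (a b : arm I) (n : nat).

(** Expectation of f at the history where the run ends, after at most n further rounds; it follows
    the recursion of [reward_to_go], including the stop at an unaffordable pull. *)
Fixpoint expect f n h : R :=
  if n is n'.+1 then
    if alg h is Some a then
      if cost a <= B - spent h then
        \sum_(w : assignment G) arm_law a w * expect f n' (observe a w :: h)
      else f h
    else f h
  else f h.

(** Any assignment may be observed, even one of probability 0; only the decisions and the budget
    restrict the histories. *)
Inductive reach : history I -> Prop :=
| reach_nil : reach [::]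
| reach_cons h a (w : assignment G) : reach h -> alg h = Some a ->
    cost a <= B - spent h -> reach (observe a w :: h).

Definition halted h := if alg h is Some a then ~~ (cost a <= B - spent h) else true.

(** Comparing only the histories at which a run ends makes it possible to use that little budget is
    left there. *)
Lemma expect_le f f' n h : reach h ->
  (forall g, reach g -> size g = (n + size h)%N \/ halted g -> f g <= f' g) ->
  expect f n h <= expect f' n h.
Proof.
elim: n h => [|n IH] h rh ff' /=; first by apply: ff' => //; left.
have H : halted h -> f h <= f' h by move=> ?; apply: ff' => //; right.
move: H; rewrite /halted; case E: (alg h) => [a|]; last by apply.
case: ifP => [ca _|_]; last by apply.
apply: ler_sum => w _; apply: ler_wpM2l; first exact: arm_law_ge0.
apply: IH; first exact: reach_cons.
by move=> g rg H; apply: ff' => //; case: H => [->|]; [left; rewrite addnS|right].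
Qed.

Lemma expect_le' f f' n : (forall g, reach g -> f g <= f' g) ->
  expect f n [::] <= expect f' n [::].
Proof. by move=> ff'; apply: expect_le => [|g rg _]; [exact: reach_nil|exact: ff']. Qed.

Lemma expect_eq f f' n h : f =1 f' -> expect f n h = expect f' n h.
Proof.
move=> E; elim: n h => [|n IH] h /=; first exact: E.
case: (alg h) => [a|]; last exact: E.
by case: ifP => _; [apply: eq_bigr => w _; rewrite IH|exact: E].
Qed.

Lemma expect_cst n h (c : R) : expect (fun _ => c) n h = c.
Proof.
elim: n h => [|n IH] h //=; case: (alg h) => [a|] //; case: ifP => // _.
by under eq_bigr do rewrite IH; rewrite -mulr_suml arm_law_sum1 mul1r.
Qed.

Lemma expectD f f' n h :
  expect (fun g => f g + f' g) n h = expect f n h + expect f' n h.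
Proof.
elim: n h => [|n IH] h //=; case: (alg h) => [a|] //; case: ifP => // _.
by rewrite -big_split; apply: eq_bigr => w _; rewrite IH mulrDr.
Qed.

Lemma expectZ f (c : R) n h : expect (fun g => c * f g) n h = c * expect f n h.
Proof.
elim: n h => [|n IH] h //=; case: (alg h) => [a|] //; case: ifP => // _.
by rewrite mulr_sumr; apply: eq_bigr => w _; rewrite IH mulrCA.
Qed.

Lemma expect_sum (T : Type) (s : seq T) (P : pred T) (F : T -> history I -> R) n h :
  expect (fun g => \sum_(i <- s | P i) F i g) n h = \sum_(i <- s | P i) expect (F i) n h.
Proof.
elim: s => [|i s IH].
  rewrite big_nil -[RHS](expect_cst n h); apply: expect_eq => g; exact: big_nil.
rewrite big_cons -IH; case: ifP => Pi.
  by rewrite -expectD; apply: expect_eq => g; rewrite big_cons Pi.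
by apply: expect_eq => g; rewrite big_cons Pi.
Qed.

(** The inequality is asked for every arm, so that it does not depend on the decisions of [alg]. *)
Definition supermartingale V := forall g a, reach g ->
  \sum_w arm_law a w * V (observe a w :: g) <= V g.

Lemma expect_supermartingale V n h : reach h -> supermartingale V -> expect V n h <= V h.
Proof.
move=> + sV; elim: n h => [|n IH] h rh //=.
case E: (alg h) => [a|] //; case: ifP => // ca.
apply: le_trans (sV h a rh); apply: ler_sum => w _.
apply: ler_wpM2l; first exact: arm_law_ge0.
by apply: IH; exact: reach_cons.
Qed.

Fixpoint tails h : seq (history I) := h :: (if h is _ :: h' then tails h' else [::]).

(** The suffixes of a history are its past states, so this says that Q held at some time of the
    run. *)
Definition hit (Q : pred (history I)) h : bool := has Q (tails h).

Lemma hit_cons Q (r : round I) h : hit Q (r :: h) = Q (r :: h) || hit Q h.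
Proof. by []. Qed.

Lemma hit_self (Q : pred (history I)) h : Q h -> hit Q h.
Proof. by rewrite /hit; case: h => [|r h] /= ->. Qed.

Lemma hit_sub (Q Q' : pred (history I)) h : reach h ->
  (forall g, reach g -> Q g -> Q' g) -> hit Q h -> hit Q' h.
Proof.
move=> rh QQ'; elim: rh => [|g a w rg IH Ea ca].
  by rewrite /hit /= !orbF; apply: QQ'; exact: reach_nil.
rewrite !hit_cons => /orP[q|/IH ->]; last by rewrite orbT.
by rewrite QQ' //; exact: reach_cons.
Qed.

Lemma hitU (Q Q' : pred (history I)) h : hit (predU Q Q') h = hit Q h || hit Q' h.
Proof. exact: has_predU. Qed.

Definition prob_hit n (Q : pred (history I)) : R := expect (fun g => (hit Q g)%:R) n [::].

Lemma prob_hit_le n (Q Q' : pred (history I)) :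
  (forall g, reach g -> Q g -> Q' g) -> prob_hit n Q <= prob_hit n Q'.
Proof.
move=> QQ'; apply: expect_le' => g rg.
by have := hit_sub rg QQ'; case: (hit Q g) => [->//|_]; rewrite ler0n.
Qed.

Lemma prob_hitU n (Q Q' : pred (history I)) :
  prob_hit n (predU Q Q') <= prob_hit n Q + prob_hit n Q'.
Proof.
rewrite -expectD; apply: expect_le' => g rg; rewrite hitU.
by case: (hit Q g); case: (hit Q' g); rewrite /= ?addr0 ?add0r // lerDl.
Qed.

Lemma prob_hit_pred0 n : prob_hit n pred0 = 0.
Proof.
rewrite -[RHS](expect_cst n [::]); apply: expect_eq => g.
by rewrite /hit has_pred0.
Qed.

Lemma prob_hit_has (T : eqType) (s : seq T) (Q : T -> pred (history I)) n :
  prob_hit n (fun g => has (Q^~ g) s) <= \sum_(i <- s) prob_hit n (Q i).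
Proof.
elim: s => [|i s IH]; first by rewrite big_nil -(prob_hit_pred0 n); apply: prob_hit_le.
rewrite big_cons; apply: le_trans (lerD (lexx _) IH).
by apply: le_trans (prob_hitU _ _ _); apply: prob_hit_le.
Qed.

(** Ville's maximal inequality. The process frozen at 1 from the first visit to Q on is still
    bounded in mean by its initial value, and it dominates the indicator of a visit. *)
Lemma ville n V (Q : pred (history I)) : supermartingale V ->
  (forall g, 0 <= V g) -> (forall g, Q g -> 1 <= V g) -> prob_hit n Q <= V [::].
Proof.
move=> sV V0 QV.
pose U g := if hit Q g then 1 else V g.
have UV g : Q g || ~~ hit Q g -> U g <= V g.
  by rewrite /U; case: ifP => // _ /orP[/QV|].
apply: le_trans (_ : expect U n [::] <= _).
  by apply: expect_le' => g _; rewrite /U; case: ifP.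
apply: le_trans (_ : U [::] <= _); last first.
  by apply: UV; rewrite /hit /= orbF; case: (Q _).
apply: expect_supermartingale; first exact: reach_nil.
move=> g a rg; rewrite {2}/U; case: ifP => hg.
  by under eq_bigr do rewrite /U hit_cons hg orbT mulr1; rewrite arm_law_sum1.
apply: le_trans (sV g a rg); apply: ler_sum => w _.
apply: ler_wpM2l; first exact: arm_law_ge0.
by apply: UV; rewrite hit_cons hg orbF; case: (Q _).
Qed.

(* Among the rounds marked by c, the events y behave as independent Bernoulli
   variables of mean q, whatever the arm. *)
Definition calibrated (c y : pred (round I)) (q : R) :=
  0 <= q <= 1 /\ forall a,
  \sum_w arm_law a w * (c (observe a w) && y (observe a w))%:R =
  q * \sum_w arm_law a w * (c (observe a w))%:R.

Lemma calibratedC c y q : calibrated c y q -> calibrated c (predC y) (1 - q).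
Proof.
case=> q01 cal; split=> [|a]; first lra.
rewrite mulrBl mul1r -cal -sumrB; apply: eq_bigr => w _.
by rewrite -mulrBr /=; case: (c _); case: (y _); rewrite /= ?subrr ?subr0.
Qed.

Definition overshoots (c y : pred (round I)) (q eta m : R) : pred (history I) := fun h =>
  (m <= (count c h)%:R) && ((q + eta) * (count c h)%:R <= (count (predI c y) h)%:R).

Definition undershoots (c y : pred (round I)) (q eta m : R) : pred (history I) := fun h =>
  (m <= (count c h)%:R) && ((count (predI c y) h)%:R <= (q - eta) * (count c h)%:R).

(* The exponential supermartingale exp (eta S - eta^2 N / 2), N counting c,
   handles all sample sizes N >= m at once, whence a bound without time. *)
Lemma prob_over n c y q eta m : calibrated c y q -> 0 <= eta ->
  prob_hit n (overshoots c y q eta m) <= expR (- (eta ^+ 2 * m / 2)).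
Proof.
case=> q01 cal eta0.
pose S h : R := (count (predI c y) h)%:R - q * (count c h)%:R.
pose V h := expR (eta * S h - eta ^+ 2 / 2 * (count c h)%:R).
have V1 : expR (- (eta ^+ 2 * m / 2)) * expR (eta ^+ 2 * m / 2) = 1.
  by rewrite -expRD addNr expR0.
have -> : expR (- (eta ^+ 2 * m / 2)) = expR (- (eta ^+ 2 * m / 2)) * V [::].
  by rewrite /V /S /= !mulr0 !subr0 mulr0 expR0 mulr1.
(* [V] starts at 1, so the rescaled process starts at the claimed bound; it is at least 1 on the
   event because there S >= eta N and N >= m. *)
apply: (@ville n (fun g => expR (- (eta ^+ 2 * m / 2)) * V g)) => [g a _|g|g /andP[mg Sg]].
- under eq_bigr do rewrite mulrCA.
  rewrite -mulr_sumr; apply: ler_wpM2l; first exact: expR_ge0.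
  pose e1 := expR (eta * (1 - q) - eta ^+ 2 / 2).
  pose e0 := expR (- (eta * q) - eta ^+ 2 / 2).
  have step w : V (observe a w :: g) = V g *
      ((~~ c (observe a w))%:R + (c (observe a w) && y (observe a w))%:R * e1 +
       (c (observe a w) && ~~ y (observe a w))%:R * e0).
    rewrite /V /S /=; case: (c _); case: (y _); rewrite /= ?(mul0r, mul1r, addr0, add0r, add0n, mulr1) //.
      by rewrite -expRD; congr expR; rewrite !natrD; ring.
    by rewrite -expRD; congr expR; rewrite !natrD; ring.
  under eq_bigr do rewrite step mulrCA.
  rewrite -mulr_sumr -[X in _ <= X]mulr1; apply: ler_wpM2l; first exact: expR_ge0.
  have [_ /(_ a) calC] := calibratedC (conj q01 cal).
  under eq_bigr do rewrite !mulrDr !mulrA.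
  rewrite !big_split /= -!mulr_suml calC cal.
  set p := \sum_w _ * (c _)%:R.
  have -> : \sum_w arm_law a w * (~~ c (observe a w))%:R = 1 - p.
    rewrite -[X in _ = X - _](arm_law_sum1 a) -sumrB; apply: eq_bigr => w _.
    by case: (c _); rewrite /= ?mulr1 ?mulr0 ?subrr ?subr0.
  have p0 : 0 <= p by apply: sumr_ge0 => w _; rewrite mulr_ge0 ?arm_law_ge0.
  have : q * e1 + (1 - q) * e0 <= 1.
    have := bernoulli_mgf_ge0 q01 eta0; rewrite /e1 /e0 !expRB.
    set d := expR (eta ^+ 2 / 2) => h; have d0 : 0 < d := expR_gt0 _.
    by rewrite !mulrA -mulrDl ler_pdivrMr ?mul1r.
  move=> /(ler_wpM2l p0); lra.
- by rewrite mulr_ge0 ?expR_ge0.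
rewrite -expRD -[X in X <= _]expR0 ler_expR.
have /(ler_wpM2l eta0) h1 : eta * (count c g)%:R <= S g by rewrite /S; lra.
have h2 : eta ^+ 2 * m <= eta ^+ 2 * (count c g)%:R by rewrite ler_wpM2l ?sqr_ge0.
nra.
Qed.

(** Too few successes among the marked rounds are too many failures, and these have mean 1 - q. *)
Lemma prob_under n c y q eta m : calibrated c y q -> 0 <= eta ->
  prob_hit n (undershoots c y q eta m) <= expR (- (eta ^+ 2 * m / 2)).
Proof.
move=> /calibratedC cal eta0; apply: le_trans (prob_over n m cal eta0).
apply: prob_hit_le => g _ /andP[mg Sg]; rewrite /overshoots mg /=.
have -> : (count (predI c (predC y)) g)%:R = (count c g)%:R - (count (predI c y) g)%:R :> R.
  apply/eqP; rewrite eq_sym subr_eq -natrD eqr_nat; apply/eqP.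
  elim: (g) => //= r g' ->; case: (c r); case: (y r); rewrite /=; lia.
lra.
Qed.

(** Each reward is replaced by its mean given the arm, so that afterwards only the numbers of pulls
    matter. *)
Lemma reward_to_goE n h : (forall a, \sum_w arm_law a w * (reward w)%:R = mu a) ->
  reward_to_go alg n h (B - spent h) =
  expect (fun g => \sum_(r <- g) mu r.1.1) n h - \sum_(r <- h) mu r.1.1.
Proof.
move=> muE; elim: n h => [|n IH] h /=; first by rewrite subrr.
case E: (alg h) => [a|]; last by rewrite subrr.
case: ifP => _; last by rewrite subrr.
under eq_bigr => w _.
  have -> : B - spent h - cost a = B - spent (observe a w :: h).
    by rewrite /spent big_cons /=; ring.
  rewrite IH big_cons /=.
  rewrite [X in _ * X](_ : _ = (reward w)%:R - mu a +
    (expect (fun g => \sum_(r <- g) mu r.1.1) n (observe a w :: h) - \sum_(r <- h) mu r.1.1)); last by ring.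
  rewrite mulrDr mulrBr [X in _ + X]mulrBr.
  over.
by rewrite big_split /= !sumrB muE -!mulr_suml arm_law_sum1 !mul1r subrr add0r.
Qed.

End Process.

(** * Counting rounds *)

Lemma big_option (R : realType) (T : finType) (F : option T -> R) :
  \sum_(o : option T) F o = F None + \sum_(t : T) F (Some t).
Proof.
rewrite (bigD1 None) //=; congr (_ + _); rewrite (reindex_omap Some id) /=; last by case.
by apply: eq_bigl => t; rewrite eqxx.
Qed.

Lemma ln_ge0_nat (R : realType) (n : nat) : 0 <= ln n%:R :> R.
Proof. by case: n => [|n]; [rewrite ln0|rewrite ln_ge0 // ler1n]. Qed.

Section Instance.
Context (R : realType) (I : causal_bandit R).
Local Notation G := (network I).
Implicit Types (h g : history I) (a b : arm I) (n : nat) (r : round I) (i : 'I_(M I)) (x : bool).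

Lemma prob_min_le i x : prob_min I <= prob i x.
Proof. exact: (bigmin_le_cond _ (fun ix : 'I_(M I) * bool => prob ix.1 ix.2) (j := (i, x))). Qed.

Lemma probE i x : prob i x = \sum_w arm_law (obs_arm : arm I) w * (value_is w i x)%:R.
Proof.
by rewrite /prob big_mkcond; apply: eq_bigr => w _; case: value_is; rewrite /= ?mulr1 ?mulr0.
Qed.

Lemma prob_le1 i x : prob i x <= 1 :> R.
Proof.
rewrite -[X in _ <= X](arm_law_sum1 (obs_arm : arm I)) probE; apply: ler_sum => w _.
by rewrite -[X in _ <= X]mulr1 ler_wpM2l ?arm_law_ge0 // lern1 leq_b1.
Qed.

Lemma reward_le1 (w : assignment G) : (reward w <= 1)%N.
Proof. by rewrite /reward; have := ltn_ord (w (Y I)); rewrite [X in (_ < X)%N]Y_binary. Qed.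

Lemma rewardE (w : assignment G) : (reward w)%:R = (0 < reward w)%N%:R :> R.
Proof. by have := reward_le1 w; case: (reward w) => [|[]]. Qed.

Definition rewarded r : bool := (0 < r.2)%N.
Definition obs_round r : bool := r.1.1 == None.
Definition obs_value i x r : bool :=
  if r is (None, Some w, _) then value_is w i x else false.

Lemma spent_cons r h : spent (r :: h) = cost r.1.1 + spent h.
Proof. by rewrite /spent big_cons. Qed.

Lemma init_ge3 : (3 <= init_rounds I)%N.
Proof. by rewrite /init_rounds; have := M_gt0 I; lia. Qed.

Lemma card_arm : #|{: option ('I_(M I) * bool)}| = init_rounds I.
Proof. by rewrite card_option card_prod card_ord card_bool /init_rounds; lia. Qed.

Lemma sum_pulls (F : arm I -> R) h :
  \sum_(r <- h) F r.1.1 = \sum_(a : option ('I_(M I) * bool)) F a * (pulls a h)%:R.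
Proof.
elim: h => [|r h IH]; first by rewrite big_nil big1 // => a _; rewrite mulr0.
rewrite big_cons IH /=; under [RHS]eq_bigr do rewrite natrD mulrDr.
rewrite big_split /=; congr (_ + _).
rewrite (bigD1 r.1.1) //= eqxx mulr1 big1 ?addr0 // => a.
by rewrite eq_sym => /negPf ->; rewrite mulr0.
Qed.

Lemma samples_obs h : samples obs_arm h = pulls obs_arm h.
Proof. by apply: eq_count => r; rewrite /informative orbF. Qed.

Lemma pulls_obsE h : pulls obs_arm h = count obs_round h.
Proof. by []. Qed.

Lemma samples_do i x h :
  samples (do_arm i x) h = (pulls (do_arm i x) h + count (predI obs_round (obs_value i x)) h)%N.
Proof.
rewrite /samples /pulls -count_predUI [X in (_ + X)%N](eq_count (a2 := pred0)); last first.
  by move=> [[[a|] [w|]] y]; rewrite /= ?andbF.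
rewrite count_pred0 addn0; apply: eq_count => -[[[a|] [w|]] y];
  by rewrite /informative /= ?orbF.
Qed.

Lemma pulls_samples a h : (pulls a h <= samples a h)%N.
Proof. by apply: sub_count => r; rewrite /informative => ->. Qed.

Section History.
Variables (alg : algorithm I) (B : R).
Local Notation reach := (reach alg B).

Lemma mu_hatE a h : reach h ->
  mu_hat a h = (count (predI (informative a) rewarded) h)%:R / (samples a h)%:R.
Proof.
move=> rh; rewrite /mu_hat; congr (_ / _); elim: rh => [|g b w rg IH _ _].
  by rewrite big_nil.
rewrite big_cons IH /= natrD /rewarded rewardE.
by case: (informative a _); rewrite /= ?add0r.
Qed.

Lemma mu_hat_ge0 a h : 0 <= mu_hat a h.
Proof. by rewrite /mu_hat divr_ge0 // sumr_ge0. Qed.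

Lemma mu_hat_le1 a h : reach h -> mu_hat a h <= 1.
Proof.
move=> rh; rewrite mu_hatE //; case: (posnP (samples a h)) => [->|s0].
  by rewrite invr0 mulr0.
by rewrite ler_pdivrMr ?ltr0n // mul1r ler_nat; apply: sub_count => r /andP[].
Qed.

Lemma mu_hat_over a h (eta m : R) : reach h -> (0 < samples a h)%N ->
  m <= (samples a h)%:R -> mu a + eta <= mu_hat a h ->
  overshoots (informative a) rewarded (mu a) eta m h.
Proof.
by move=> rh s0 ms; rewrite mu_hatE // ler_pdivlMr ?ltr0n // => H; rewrite /overshoots ms.
Qed.

Lemma mu_hat_under a h (eta m : R) : reach h -> (0 < samples a h)%N ->
  m <= (samples a h)%:R -> mu_hat a h <= mu a - eta ->
  undershoots (informative a) rewarded (mu a) eta m h.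
Proof.
by move=> rh s0 ms; rewrite mu_hatE // ler_pdivrMr ?ltr0n // => H; rewrite /undershoots ms.
Qed.

Lemma mu_hat_max_ge i x h : mu_hat (do_arm i x) h <= mu_hat_max h.
Proof.
exact: (le_bigmax_cond _
  (fun ix : 'I_(M I) * bool => mu_hat (do_arm ix.1 ix.2) h) (j := (i, x))).
Qed.

Lemma mu_hat_max_le h (c : R) : 0 <= c ->
  (forall i x, mu_hat (do_arm i x) h <= c) -> mu_hat_max h <= c.
Proof. by move=> c0 H; apply: bigmax_le => // -[i x] _; exact: H. Qed.

(** P is evaluated at the arm pulled and at the history before that pull. *)
Fixpoint steps (P : arm I -> history I -> bool) h : nat :=
  if h is r :: h' then (P r.1.1 h' + steps P h')%N else 0%N.

Lemma pulls_steps a h : pulls a h = steps (fun b _ => b == a) h.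
Proof. by elim: h => //= r h ->. Qed.

Lemma steps_le (P P' : arm I -> history I -> bool) h : reach h ->
  (forall a g, reach g -> alg g = Some a -> cost a <= B - spent g -> P a g -> P' a g) ->
  (steps P h <= steps P' h)%N.
Proof.
move=> rh PP'; elim: rh => //= g a w rg IH Ea ca.
by apply: leq_add => //; have := PP' a g rg Ea ca; case: (P a g) => // ->.
Qed.

Lemma stepsU (P P' : arm I -> history I -> bool) h :
  (steps (fun a g => P a g || P' a g) h <= steps P h + steps P' h)%N.
Proof.
elim: h => //= r h IH; rewrite addnACA; apply: leq_add => //.
by case: (P _ _); case: (P' _ _).
Qed.

Lemma steps_notin (Q : pred (history I)) P h : ~~ hit Q h ->
  steps P h = steps (fun a g => P a g && ~~ Q g) h.
Proof.
elim: h => //= r h IH; rewrite hit_cons negb_or => /andP[_ hh]; rewrite IH //.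
have -> : Q h = false by apply: contraNF hh; exact: hit_self.
by rewrite andbT.
Qed.

(* idx numbers the steps selected by P. *)
Definition indexing (P : arm I -> history I -> bool) (idx : history I -> nat) :=
  forall r h, (idx h + P r.1.1 h <= idx (r :: h))%N.

Lemma indexing_size P : indexing P (fun h => size h).
Proof. by move=> r h /=; case: (P _ _); rewrite ?addn0 ?addn1. Qed.

Lemma indexing_pulls a (P : arm I -> history I -> bool) :
  (forall b h, P b h -> b == a) -> indexing P (pulls a).
Proof.
move=> Pa r h /=; rewrite addnC leq_add2r.
by have := Pa r.1.1 h; case: (P _ _) => // ->.
Qed.

(** Each selected step raises the index by at least 1. The induction also keeps the count below the
    index, which bounds it when the index is about to reach K. *)
Lemma steps_lt_bound P idx (K : R) h : indexing P idx -> 0 <= K ->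
  (steps (fun a g => P a g && ((idx g)%:R < K)) h)%:R <= K + 1.
Proof.
move=> ix K0; pose P' a g := P a g && ((idx g)%:R < K).
suff [] : (steps P' h <= idx h)%N /\ (steps P' h)%:R <= K + 1 by [].
elim: h => [|r h [IH1 IH2]] /=; first by split=> //; lra.
have := ix r h; have -> : P' r.1.1 h = P r.1.1 h && ((idx h)%:R < K) by [].
case: (P _ _) => /= ixr; last by split=> //; lia.
case: ltP => hK; last by split=> //; lia.
split; first by lia.
by rewrite natrD addrC lerD2r (le_trans _ (ltW hK)) // ler_nat.
Qed.

(** Selected steps have distinct indices, so each k accounts for at most one of them. Expected
    counts thus become sums of probabilities over the index, which may be a number of samples
    instead of time. *)
Lemma steps_hit P idx (Q : pred (history I)) n h : indexing P idx -> (idx h <= n)%N ->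
  (steps (fun a g => P a g && Q g) h <= \sum_(k < n) hit (fun g => (idx g == k) && Q g) h)%N.
Proof.
move=> ix ihn; apply: (@leq_trans (\sum_(k < idx h) hit (fun g => (idx g == k) && Q g) h)%N); last first.
  rewrite -!(big_mkord xpredT (fun k => nat_of_bool (hit (fun g => (idx g == k) && Q g) h))).
  by rewrite [X in (_ <= X)%N](big_cat_nat (n := idx h)) //= leq_addr.
elim: h {ihn} => [|r h IH] //=.
have ixr := ix r h.
rewrite -(big_mkord xpredT (fun k => nat_of_bool (hit (fun g => (idx g == k) && Q g) (r :: h)))).
have mono m k : (m <= k)%N -> (\sum_(0 <= j < m) hit (fun g => (idx g == j) && Q g) (r :: h) <=
    \sum_(0 <= j < k) hit (fun g => (idx g == j) && Q g) (r :: h))%N.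
  by move=> mk; rewrite [X in (_ <= X)%N](big_cat_nat (n := m)) //= leq_addr.
apply: leq_trans (mono _ _ ixr).
have {}IH : (steps (fun a g => P a g && Q g) h <=
    \sum_(0 <= j < idx h) hit (fun g => (idx g == j) && Q g) (r :: h))%N.
  apply: leq_trans IH _; rewrite big_mkord; apply: leq_sum => k _.
  by rewrite hit_cons; case: (hit _ h); rewrite ?orbT.
case Ph : (P r.1.1 h); last by rewrite addn0.
rewrite /= addn1 big_nat_recr //= addnC; apply: leq_add => //.
case Qh : (Q h) => //.
rewrite lt0b hit_cons; apply/orP; right.
by apply: hit_self; rewrite eqxx.
Qed.

End History.

Hypothesis nobd : no_backdoor I.
Hypothesis gamma1 : 1 <= gamma I.
Hypothesis pmin0 : 0 < prob_min I.

Lemma prob_gt0 i x : 0 < prob i x :> R.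
Proof. exact: lt_le_trans pmin0 (prob_min_le i x). Qed.

Lemma arm_law_mu a : \sum_w arm_law a w * (reward w)%:R = mu a.
Proof. by case: a => [[i x]|] //; apply: mu_doE => //; exact: prob_gt0. Qed.

Lemma mu_ge0 a : 0 <= mu a.
Proof. by rewrite -arm_law_mu sumr_ge0 // => w _; rewrite mulr_ge0 ?arm_law_ge0. Qed.

Lemma mu_le1 a : mu a <= 1.
Proof.
rewrite -arm_law_mu -[X in _ <= X](arm_law_sum1 a); apply: ler_sum => w _.
by rewrite -[X in _ <= X]mulr1 ler_wpM2l ?arm_law_ge0 // lern1 reward_le1.
Qed.

(** The samples of [do_arm i x] pool two kinds of rounds: interventions, of mean E[Y | do(X_i = x)],
    and observations with X_i = x, of mean E[Y | X_i = x]. The no-backdoor identity makes the means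
    equal. *)
Lemma calibrated_reward a : calibrated (informative a) rewarded (mu a).
Proof.
split=> [|b]; first by rewrite mu_ge0 mu_le1.
have [->|ba] := eqVneq b a.
  rewrite (eq_bigr (fun w => arm_law a w * (reward w)%:R)); last first.
    by move=> w _; rewrite /informative eqxx /= rewardE.
  rewrite arm_law_mu; under eq_bigr do rewrite /informative eqxx mulr1.
  by rewrite arm_law_sum1 mulr1.
case: a b ba => [[i x]|] [[j y]|] ba; rewrite /informative /= ?(negPf ba) /=.
- rewrite [LHS]big1 => [|w _]; last by rewrite mulr0.
  by rewrite [X in _ = _ * X]big1 ?mulr0 // => w _; rewrite mulr0.
- rewrite -probE divfK ?gt_eqF ?prob_gt0 // [RHS]big_mkcond /=; apply: eq_bigr => w _.
  by rewrite rewardE; case: value_is; rewrite /= ?mulr0.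
- rewrite [LHS]big1 => [|w _]; last by rewrite mulr0.
  by rewrite [X in _ = _ * X]big1 ?mulr0 // => w _; rewrite mulr0.
- by rewrite eqxx in ba.
Qed.

Lemma calibrated_value i x : calibrated obs_round (obs_value i x) (prob i x : R).
Proof.
split=> [|[a|]]; first by rewrite prob_le1 ltW ?prob_gt0.
  rewrite [LHS]big1 => [|w _]; last by rewrite mulr0.
    by rewrite [X in _ = _ * X]big1 ?mulr0 // => w _; rewrite mulr0.
by under [X in _ = _ * X]eq_bigr do rewrite /= mulr1; rewrite arm_law_sum1 mulr1 probE.
Qed.

End Instance.

(** * Runs of the algorithm *)

(** From e^(-1/2) >= 1/2. After the initial rounds t >= 4, so the cap sqrt (ln t) on beta is at
    least 1. *)
Lemma ln4_ge1 (R : realType) : 1 <= ln 4 :> R.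
Proof.
rewrite -[X in X <= _]expRK ler_ln ?posrE ?expR_gt0 //.
have h := expR_ge1Dx (- 2^-1 : R).
have -> : (1 : R) = 2^-1 * 2%:R by rewrite mulVf ?pnatr_eq0.
rewrite expRM_natr.
have e0 : 0 < expR (2^-1 : R) := expR_gt0 _.
have : expR (2^-1 : R) <= 2.
  have := ler_wpM2l (ltW e0) h; rewrite expRN mulfV ?gt_eqF //; lra.
nra.
Qed.

Section Algorithm.
Context (R : realType) (I : causal_bandit R).
Local Notation G := (network I).
Implicit Types (h g : history I) (a b : arm I) (n : nat) (r : round I) (i : 'I_(M I)) (x : bool).

Hypothesis nobd : no_backdoor I.
Hypothesis gamma1 : 1 <= gamma I.
Hypothesis pmin0 : 0 < prob_min I.

Variables (alg : algorithm I) (B : R).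
Hypothesis budget : 2 * gamma I * (M I)%:R + 1 <= B.
Hypothesis crm : crm_nb_alg B alg.
Local Notation reach := (reach alg B).
Local Notation halted := (halted alg B).
Local Notation horizon := (Num.truncn B).

Lemma cost_ge1 a : 1 <= cost a.
Proof. by case: a. Qed.

Lemma cost_le_gamma a : cost a <= gamma I.
Proof. by case: a. Qed.

Lemma B_ge1 : 1 <= B.
Proof.
apply: le_trans budget; rewrite lerDr !mulr_ge0 //; exact: le_trans ler01 gamma1.
Qed.

Lemma spent_le h : reach h -> spent h <= B.
Proof.
case=> [|g a w _ _ ca]; last by rewrite spent_cons /=; lra.
by rewrite /spent big_nil (le_trans _ B_ge1).
Qed.

Lemma size_le_spent h : (size h)%:R <= spent h.
Proof.
elim: h => [|r h IH]; first by rewrite /spent big_nil.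
by rewrite spent_cons -natr1 addrC lerD ?cost_ge1.
Qed.

Lemma size_le_horizon h : reach h -> (size h <= horizon)%N.
Proof.
move=> rh; rewrite truncn_ge_nat; last exact: le_trans B_ge1.
exact: le_trans (size_le_spent h) (spent_le rh).
Qed.

Lemma size_le_B h : reach h -> (size h)%:R <= B.
Proof. move=> rh; exact: le_trans (size_le_spent h) (spent_le rh). Qed.

Definition arms_of h : seq (option ('I_(M I) * bool)) := [seq r.1.1 | r <- h].

Lemma pulls_arms_of a h : pulls a h = count_mem a (arms_of h).
Proof. by rewrite /pulls count_map. Qed.

Lemma init_uniq h : reach h -> (size h <= init_rounds I)%N -> uniq (arms_of h).
Proof.
elim=> //= g a w rg IH Ea ca sg; rewrite IH ?andbT 1?ltnW //.
have := crm g; rewrite /crm_nb_decision sg Ea => -[b [<-]].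
by rewrite pulls_arms_of => /eqP; rewrite -leqn0 leqNgt -has_count has_pred1.
Qed.

Lemma init_covers h a : reach h -> (init_rounds I <= size h)%N -> (0 < pulls a h)%N.
Proof.
elim=> [|g b w rg IH Eb cb].
  by rewrite leqNgt (leq_trans _ (init_ge3 I)).
rewrite leq_eqVlt => /predU1P[sz|/IH H]; last by rewrite /= (leq_trans H) // leq_addl.
have rh : reach (observe b w :: g) by exact: reach_cons.
have := init_uniq rh; rewrite -sz leqnn => /(_ isT) u.
rewrite pulls_arms_of -has_count has_pred1.
have E : #|arms_of (observe b w :: g)| = #|{: option ('I_(M I) * bool)}|.
  by move/card_uniqP: u => ->; rewrite card_arm /arms_of size_map sz.
have /(subset_cardP E) -> // : arms_of (observe b w :: g) \subset {: option ('I_(M I) * bool)}.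
by apply/fintype.subsetP.
Qed.

Lemma samples_gt0 h a : reach h -> (init_rounds I <= size h)%N -> (0 < samples a h)%N.
Proof. by move=> rh /(init_covers a rh) H; exact: leq_trans H (pulls_samples a h). Qed.

(** The arms pulled so far and a are distinct, so together they cost at most 2 gamma M + 1. *)
Lemma spent_init h a : uniq (arms_of h) -> pulls a h = 0%N -> spent h + cost a <= B.
Proof.
move=> u; rewrite pulls_arms_of => /eqP; rewrite -leqn0 leqNgt -has_count has_pred1 => na.
apply: le_trans budget.
have -> : spent h + cost a = \sum_(b <- ((a : option ('I_(M I) * bool)) :: arms_of h)) cost (b : arm I).
  by rewrite big_cons addrC /spent /arms_of big_map.
rewrite big_uniq /=; last by rewrite na u.
apply: le_trans (_ : \sum_(b : option ('I_(M I) * bool)) cost (b : arm I) <= _).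
  rewrite [X in X <= _]big_mkcond; apply: ler_sum => b _; case: ifP => // _.
  by rewrite (le_trans _ (cost_ge1 b)).
rewrite big_option /= sumr_const card_prod card_ord card_bool -(mulr_natl _ (M I * 2)) natrM.
by lra.
Qed.

Variant step_spec h a : Prop :=
| StepInit of (size h < init_rounds I)%N
| StepForced of (init_rounds I <= size h)%N & a = obs_arm
    & (pulls obs_arm h)%:R < beta h ^+ 2 * ln (size h).+1%:R
| StepLast of (init_rounds I <= size h)%N & a = obs_arm & B - spent h < gamma I
| StepUcb of (init_rounds I <= size h)%N
    & beta h ^+ 2 * ln (size h).+1%:R <= (pulls obs_arm h)%:R
    & (forall b, ucb b h <= ucb a h).

Lemma stepP h a : alg h = Some a -> step_spec h a.
Proof.
move=> Ea; have := crm h; rewrite /crm_nb_decision Ea.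
case: ltnP => sz; first by move=> _; exact: StepInit.
case: ifP => // _; case: ltP => /= [p [->]|p]; first exact: StepForced.
case: ltP => /= [l [->]|l [b [->]]]; first exact: StepLast.
exact: StepUcb.
Qed.

(** Costs are at least 1, so floor(B) rounds spend more than B - 1. Before that the algorithm stops
    only for lack of budget: with at least 1 left it always names an affordable arm. *)
Lemma halted_spent h : reach h -> size h = horizon \/ halted h -> B - spent h < 1.
Proof.
move=> rh [sz|].
  have := size_le_spent h; rewrite sz => H.
  have /andP[_] := truncn_itv (le_trans ler01 B_ge1).
  by rewrite -natr1; lra.
rewrite /halted; have := crm h; rewrite /crm_nb_decision.
case: ltnP => sz.
  case=> a -> pa; have := spent_init (init_uniq rh (ltnW sz)) pa; lra.
case: ltP => // rem; case: ltP => /= [p ->|p]; first by rewrite rem.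
case: ltP => /= [l ->|l [b -> _]]; first by rewrite rem.
by have := cost_le_gamma b; lra.
Qed.

Lemma beta_ge1 h : reach h -> 1 <= beta h.
Proof.
elim=> {h} [|g a w rg IH Ea ca] //=; case: leqP => // sz.
have rh : reach (observe a w :: g) by exact: reach_cons.
have ls : 1 <= ln (size g).+1%:R :> R.
  apply: le_trans (ln4_ge1 R) _.
  by rewrite ler_ln ?posrE ?ltr0n ?ler_nat //; have := (init_ge3 I); lia.
move: (observe a w :: g) rh => h rh.
case: ltP => // gap; rewrite le_min; apply/andP; split.
  rewrite ler_pdivlMr ?subr_gt0 // mul1r.
  have h1 : mu_hat_max h / gamma I <= 1.
    rewrite ler_pdivrMr ?mul1r; last exact: lt_le_trans gamma1.
    by apply: le_trans gamma1; apply: mu_hat_max_le => // i x; exact: (mu_hat_le1 _ rh).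
  have h2 := mu_hat_ge0 obs_arm h.
  have h3 : 1 <= Num.sqrt (2 : R) by rewrite -[X in X <= _]sqrtr1 ler_sqrt // ler1n.
  lra.
by rewrite -[X in X <= _]sqrtr1 ler_sqrt; lra.
Qed.

(* beta >= 1 forces observations as long as the number of them is below ln t. *)
Lemma obs_growth (m : R) (s0 : nat) h : reach h -> (init_rounds I <= s0)%N ->
  m <= ln s0%:R -> Num.min m ((size h)%:R - s0%:R) <= (pulls obs_arm h)%:R.
Proof.
move=> rh ms0 ls0; elim: rh => [|g a w rg IH Ea ca].
  by rewrite ge_min /= sub0r lerNl oppr0 ler0n orbT.
have [sg|sg] := ltnP (size g) s0.
  by rewrite ge_min; apply/orP; right; apply: (@le_trans _ _ 0); rewrite ?subr_le0 ?ler_nat.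
have obs : a = obs_arm -> Num.min m ((size (observe a w :: g))%:R - s0%:R) <=
    (pulls obs_arm (observe a w :: g))%:R.
  move=> ->; rewrite /= add1n -!natr1; move: IH; rewrite !ge_min => /orP[] H; apply/orP; [left|right]; lra.
case: (stepP Ea) => [sz|_ /obs //|_ /obs //|_ H _]; first by lia.
rewrite ge_min; apply/orP; left; apply: le_trans ls0 _.
apply: (@le_trans _ _ (pulls obs_arm g)%:R); last by rewrite ler_nat /= leq_addl.
apply: le_trans H; apply: (@le_trans _ _ (1 * ln (size g).+1%:R)).
  by rewrite mul1r ler_ln ?posrE ?ltr0n ?ler_nat //; have := (init_ge3 I); lia.
by rewrite ler_wpM2r ?ln_ge0_nat // expr_ge1 // ?beta_ge1 // (le_trans ler01) // beta_ge1.
Qed.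

Lemma reward_to_go_le (v b : R) (alg' : algorithm I) n h :
  (forall a, value a <= v) -> 0 <= v -> 0 <= b -> reward_to_go alg' n h b <= v * b.
Proof.
move=> av v0; elim: n h b => [|n IH] h b b0 /=; first exact: mulr_ge0.
case: (alg' h) => [a|]; last exact: mulr_ge0.
case: ifP => ca; last exact: mulr_ge0.
apply: le_trans (_ : \sum_w arm_law a w * ((reward w)%:R + v * (b - cost a)) <= _).
  by apply: ler_sum => w _; rewrite ler_wpM2l ?arm_law_ge0 // lerD2l IH // subr_ge0.
under eq_bigr do rewrite mulrDr.
rewrite big_split /= -mulr_suml arm_law_sum1 mul1r (arm_law_mu nobd pmin0).
have := av a; rewrite /value ler_pdivrMr; last exact: lt_le_trans (cost_ge1 a).
lra.
Qed.

(** No algorithm earns more than v B, with v the best value. Less than 1 of the budget stays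
    unspent, whence the term [value astar]; the budget that is spent loses cost times value gap at
    each pull. *)
Lemma regret_le astar : (forall b, value b <= value astar) ->
  regret alg B <= value astar + \sum_(a : option ('I_(M I) * bool))
    cost (a : arm I) * value_gap astar a * expect alg B (fun g => (pulls a g)%:R) horizon [::].
Proof.
move=> best; set v := value astar.
have v0 : 0 <= v.
  rewrite /v /value divr_ge0 // ?(mu_ge0 nobd pmin0) //.
  exact: le_trans (cost_ge1 _).
have B0 : 0 <= B := le_trans ler01 B_ge1.
have opt : optimal_reward I B <= v * B.
  apply: ge_sup; first by exists (expected_reward alg B); exists alg.
  by move=> _ [alg' _ <-]; apply: reward_to_go_le.
have := reward_to_goE alg B horizon [::] (arm_law_mu nobd pmin0).
rewrite big_nil subr0 {1}/spent big_nil subr0 => E.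
rewrite /regret {1}/expected_reward E.
have : v * B - v <= expect alg B (fun g => \sum_(r <- g) mu r.1.1 + \sum_(a : option ('I_(M I) * bool))
    cost (a : arm I) * value_gap astar a * (pulls a g)%:R) horizon [::].
  rewrite -[X in X <= _](expect_cst alg B horizon [::]).
  apply: expect_le => [|g rg]; first exact: reach_nil.
  rewrite addn0 => /(halted_spent rg) sg.
  rewrite !(sum_pulls (@mu R I)) -big_split /=.
  rewrite (eq_bigr (fun a => v * (cost (a : arm I) * (pulls a g)%:R))); last first.
    move=> a _; rewrite -mulrDl mulrA; congr (_ * _).
    rewrite /value_gap -/v /value mulrBr [X in _ + (_ - X)]mulrCA mulfV ?mulr1; first by ring.
    by rewrite gt_eqF // (lt_le_trans _ (cost_ge1 a)).
  rewrite -mulr_sumr -(sum_pulls (@cost R I)) -/(spent g).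
  rewrite -[X in _ - X]mulr1 -mulrBr; apply: ler_wpM2l => //; lra.
rewrite expectD expect_sum /=.
under [X in _ <= _ + X -> _]eq_bigr do rewrite expectZ.
lra.
Qed.

End Algorithm.

(** * Summable errors and confidence radii *)

Definition geom_sum (R : realType) (c : R) : R := (1 - expR (- c))^-1.

Lemma sum_expR_le (R : realType) (c : R) n : 0 < c ->
  \sum_(k < n) expR (- (c * k%:R)) <= geom_sum c.
Proof.
move=> c0; set q := expR (- c); have q1 : q < 1 by rewrite expR_lt1 oppr_lt0.
have q0 : 0 <= q by exact: expR_ge0.
under eq_bigr do rewrite -mulNr expRM_natr -/q.
rewrite /geom_sum -/q -[X in _ <= X]mul1r ler_pdivlMr ?subr_gt0 //.
have := subrX1 q n; have := exprn_ge0 n q0.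
set S := \sum_(i < n) _ => h1 h2.
have -> : S * (1 - q) = - ((q - 1) * S) by ring.
by rewrite -h2; lra.
Qed.

Lemma sum_inv_sqr_le (R : realType) n : \sum_(t < n) (t%:R ^+ 2)^-1 <= 2 :> R.
Proof.
case: n => [|[|n]]; [by rewrite big_ord0|by rewrite big_ord1 expr0n invr0|].
(* Telescoping with 1 / t^2 <= 1 / (t - 1) - 1 / t; the term t = 0 vanishes because the inverse of 0
   is 0. *)
suff H : \sum_(t < n.+2) (t%:R ^+ 2)^-1 <= 2 - n.+1%:R^-1 :> R.
  by apply: le_trans H _; rewrite gerBl invr_ge0.
elim: n => [|n IH].
  by rewrite 2!big_ord_recr big_ord0 /= expr0n invr0 expr1n invr1; lra.
rewrite big_ord_recr /=; apply: le_trans (lerD IH (lexx _)) _.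
have n0 : 0 < n.+1%:R :> R by rewrite ltr0n.
rewrite -[n.+2%:R]natr1; move: (n.+1%:R : R) n0 => u n0 {IH}.
have [u0 u1] : u != 0 /\ u + 1 != 0 by split; rewrite gt_eqF //; lra.
rewrite -subr_ge0 [X in _ <= X](_ : _ = (u * (u + 1) ^+ 2)^-1); last by field; rewrite u0 u1.
by rewrite invr_ge0 mulr_ge0 ?sqr_ge0 // ltW.
Qed.

Lemma expR_small (R : realType) (c d : R) : 0 < c -> 0 < d ->
  exists2 m0, 0 <= m0 & forall m, m0 <= m -> expR (- (c * m)) <= d.
Proof.
move=> c0 d0; exists (Num.max 0 (- ln d / c)); first by rewrite le_max lexx.
move=> m; rewrite ge_max => /andP[_]; rewrite ler_pdivrMr // => H.
by rewrite -[d]lnK ?posrE // ler_expR; lra.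
Qed.

Section Concentration.
Context (R : realType) (I : causal_bandit R).
Implicit Types (h g : history I) (a b : arm I) (n : nat) (r : round I) (i : 'I_(M I)) (x : bool).

Hypothesis nobd : no_backdoor I.
Hypothesis gamma1 : 1 <= gamma I.
Hypothesis pmin0 : 0 < prob_min I.

Variables (alg : algorithm I) (B : R).
Hypothesis budget : 2 * gamma I * (M I)%:R + 1 <= B.
Hypothesis crm : crm_nb_alg B alg.
Local Notation reach := (reach alg B).
Local Notation horizon := (Num.truncn B).

Lemma expect_steps (P : arm I -> history I -> bool) idx (Q : nat -> pred (history I)) :
  indexing P idx -> (forall h, reach h -> (idx h <= size h)%N) ->
  expect alg B (fun g => (steps (fun a h => P a h && Q (idx h) h) g)%:R) horizon [::] <=
  \sum_(k < horizon) prob_hit alg B horizon (Q k).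
Proof.
move=> ix ih; rewrite -expect_sum; apply: expect_le' => g rg.
have := steps_hit (fun h => Q (idx h) h) ix (leq_trans (ih g rg) (size_le_horizon gamma1 budget rg)).
move=> H; apply: (@le_trans _ _ _%:R); first by rewrite ler_nat; exact: H.
rewrite natr_sum; apply: ler_sum => k _; rewrite ler_nat.
suff : hit (fun h => (idx h == k) && Q (idx h) h) g -> hit (Q k) g.
  by case: (hit _ g) => // ->.
by apply: (hit_sub rg) => h _ /andP[/eqP ->].
Qed.

(** Confidence radius for k + 1 samples; the shift avoids the sample size 0. *)
Definition scale (s L : R) (k : nat) : R := Num.sqrt (s * L / k.+1%:R).

Lemma prob_scale_over (c y : pred (round I)) q n (s L : R) k : calibrated c y q -> 0 <= s * L ->
  prob_hit alg B n (overshoots c y q (scale s L k) k.+1%:R) <= expR (- (s * L / 2)).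
Proof.
move=> cal sL; apply: le_trans (prob_over alg B n _ cal (sqrtr_ge0 _)) _.
by rewrite sqr_sqrtr ?divr_ge0 // divfK ?pnatr_eq0.
Qed.

Lemma prob_scale_under (c y : pred (round I)) q n (s L : R) k : calibrated c y q -> 0 <= s * L ->
  prob_hit alg B n (undershoots c y q (scale s L k) k.+1%:R) <= expR (- (s * L / 2)).
Proof.
move=> cal sL; apply: le_trans (prob_under alg B n _ cal (sqrtr_ge0 _)) _.
by rewrite sqr_sqrtr ?divr_ge0 // divfK ?pnatr_eq0.
Qed.

(** Union over the sample sizes 1, ..., t of the deviations that can push the index of a below its
    value at time t. *)
Definition low_ucb a (t : nat) : pred (history I) := fun h =>
  has (fun k => undershoots (informative a) (@rewarded R I) (mu a) (scale 8 (ln t%:R) k) k.+1%:R h) (iota 0 t).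

Lemma samples_le_size a h : (samples a h <= size h)%N.
Proof. exact: count_size. Qed.

Lemma low_ucbP a h : reach h -> (init_rounds I <= size h)%N ->
  ucb a h < value a -> low_ucb a (size h) h.
Proof.
move=> rh sz; rewrite /ucb /value ltr_pM2r; last first.
  by rewrite invr_gt0 (lt_le_trans _ (cost_ge1 gamma1 a)).
move=> H; apply/hasP; have s0 := samples_gt0 crm a rh sz.
exists (samples a h).-1; first by rewrite mem_iota /= add0n prednK // samples_le_size.
apply: (mu_hat_under rh) => //; first by rewrite prednK.
rewrite /scale prednK //; lra.
Qed.

(** Each of the t sample sizes contributes exp (- 4 ln t) = t^(-4). *)
Lemma prob_low_ucb a t n : prob_hit alg B n (low_ucb a t) <= (t%:R ^+ 2)^-1.
Proof.
apply: le_trans (prob_hit_has _ _ _ _ _) _.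
case: (posnP t) => [->|t0]; first by rewrite big_nil invr_ge0 sqr_ge0.
have tR : 0 < t%:R :> R by rewrite ltr0n.
have L0 : 0 <= ln t%:R :> R by apply: ln_ge0_nat.
apply: le_trans (_ : \sum_(k <- iota 0 t) (t%:R ^+ 4)^-1 <= _).
  apply: ler_sum => k _; apply: le_trans (prob_scale_under _ _ (calibrated_reward nobd pmin0 a) _) _.
    by rewrite mulr_ge0.
  have -> : 8 * ln t%:R / 2 = ln (t%:R ^+ 4) :> R by rewrite lnXn // mulr_natl; lra.
  by rewrite expRN lnK // posrE exprn_gt0.
rewrite big_const_seq count_predT size_iota iter_addr addr0 -[X in X <= _]mulr_natl.
rewrite ler_pdivrMr ?exprn_gt0 // (_ : t%:R ^+ 4 = t%:R ^+ 2 * t%:R ^+ 2); last by ring.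
rewrite mulrA mulVf ?mul1r ?expf_neq0 ?gt_eqF // expr2.
by apply: ler_peMr; [exact: ltW|rewrite ler1n].
Qed.

End Concentration.

(** * An intervention is the best arm *)

Section Exploration.
Context (R : realType) (I : causal_bandit R).
Implicit Types (h g : history I) (a b : arm I) (n : nat) (r : round I) (i : 'I_(M I)) (x : bool).

Hypothesis nobd : no_backdoor I.
Hypothesis gamma1 : 1 <= gamma I.
Hypothesis pmin0 : 0 < prob_min I.

Definition gap_hat h : R := mu_hat_max h / gamma I - mu_hat obs_arm h.

Lemma beta_gap h : (init_rounds I < size h)%N -> 0 < gap_hat h ->
  beta h ^+ 2 = Num.min (8 / gap_hat h ^+ 2) (ln (size h)%:R).
Proof.
move=> sz g0; have L0 := ln_ge0_nat R (size h).
have s2 : Num.sqrt (2 : R) ^+ 2 = 2 by rewrite sqr_sqrtr.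
have E : (2 * Num.sqrt 2 / gap_hat h) ^+ 2 = 8 / gap_hat h ^+ 2.
  by rewrite expr_div_n exprMn s2; congr (_ / _); lra.
have q0 : 0 <= 2 * Num.sqrt 2 / gap_hat h by rewrite divr_ge0 ?mulr_ge0 ?sqrtr_ge0 // ltW.
case: h sz g0 L0 E q0 => // r h sz g0 L0 E q0.
have -> : beta (r :: h) = Num.min (2 * Num.sqrt 2 / gap_hat (r :: h)) (Num.sqrt (ln (size (r :: h))%:R)).
  by rewrite /= leqNgt sz /= -subr_gt0 -/(gap_hat (r :: h)) g0.
rewrite -{2}(sqr_sqrtr L0) -E !minEle ler_pXn2r ?nnegrE ?sqrtr_ge0 //.
by case: ifP.
Qed.

(** A positive estimated gap bounds beta^2 by 8 / gap^2. If it is not positive, beta may keep an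
    older value, but then the conclusion is immediate. In the initial phase beta = 1 contradicts 8 /
    e^2 > 1. *)
Lemma beta_large_gap h (e : R) : 0 < e <= 1 -> 8 / e ^+ 2 < beta h ^+ 2 -> gap_hat h < e.
Proof.
move=> /andP[e0 e1] be.
have e8 : 1 < 8 / e ^+ 2.
  rewrite ltr_pdivlMr ?exprn_gt0 // mul1r; apply: (@le_lt_trans _ _ 1); last lra.
  by rewrite exprn_ile1 // ltW.
case: (ltP 0 (gap_hat h)) => [g0|g0]; last exact: le_lt_trans e0.
case: (ltnP (init_rounds I) (size h)) => sz; last first.
  have b1 : beta h = 1 by case: (h) sz => //= r h' ->.
  by move: be; rewrite b1 expr1n; lra.
move: be; rewrite beta_gap // lt_min => /andP[be _].
rewrite ltNge; apply/negP => eg.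
move: be; apply/negP; rewrite -leNgt ler_pM2l // lef_pV2 ?posrE ?exprn_gt0 //.
by rewrite ler_pXn2r ?nnegrE //; exact: ltW.
Qed.

Variables (istar : 'I_(M I)) (xstar : bool).
Local Notation astar := (do_arm istar xstar).
Local Notation v := (value astar).
Local Notation d0 := (value_gap astar obs_arm).
Local Notation p := (prob istar xstar).
Hypothesis gap0 : 0 < d0.

Lemma value_obs : value (obs_arm : arm I) = mu (obs_arm : arm I).
Proof. by rewrite /value divr1. Qed.

Lemma muE a : @mu R I a = value a * cost a.
Proof. by rewrite /value divfK // gt_eqF // (lt_le_trans _ (cost_ge1 gamma1 a)). Qed.

Lemma gap0_le1 : d0 <= 1.
Proof.
have g0 : 0 < gamma I := lt_le_trans ltr01 gamma1.
have vE : v = mu astar / gamma I by [].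
have h1 := mu_le1 nobd pmin0 astar; have h2 := mu_ge0 nobd pmin0 (obs_arm : arm I).
rewrite /value_gap lerBlDr value_obs vE ler_pdivrMr; last exact: g0.
apply: (le_trans h1); rewrite mulrDl mul1r; apply: (le_trans gamma1).
by rewrite lerDl; apply: mulr_ge0 => //; exact: ltW.
Qed.

(* Rules out, once n observations are available, that the empirical gap
   underestimates d0 by a factor 2. *)
Definition bad_obs (n : nat) : pred (history I) :=
  predU (overshoots (informative obs_arm) (@rewarded R I) (mu (obs_arm : arm I)) (d0 / 4) n%:R)
  (predU (undershoots (@obs_round R I) (obs_value istar xstar) p (p / 2) n%:R)
   (undershoots (informative astar) (@rewarded R I) (mu astar) (gamma I * (d0 / 4)) (p / 2 * n%:R))).

Definition bad_obs_total : R :=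
  geom_sum ((d0 / 4) ^+ 2 / 2) + geom_sum ((p / 2) ^+ 2 / 2) +
  geom_sum ((gamma I * (d0 / 4)) ^+ 2 / 2 * (p / 2)).

Variables (alg : algorithm I) (B : R).
Hypothesis budget : 2 * gamma I * (M I)%:R + 1 <= B.
Hypothesis crm : crm_nb_alg B alg.
Local Notation reach := (reach alg B).
Local Notation horizon := (Num.truncn B).

Lemma prob_bad_obs n k :
  \sum_(j < k) prob_hit alg B n (bad_obs j) <= bad_obs_total.
Proof.
have p0 := prob_gt0 pmin0 istar xstar.
have g0 : 0 < gamma I := lt_le_trans ltr01 gamma1.
have d4 : 0 < d0 / 4 by rewrite divr_gt0.
apply: le_trans (_ : \sum_(j < k) (expR (- ((d0 / 4) ^+ 2 / 2 * j%:R)) +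
   expR (- ((p / 2) ^+ 2 / 2 * j%:R)) +
   expR (- ((gamma I * (d0 / 4)) ^+ 2 / 2 * (p / 2) * j%:R))) <= _).
  apply: ler_sum => j _; apply: le_trans (prob_hitU _ _ _ _ _) _.
  rewrite -addrA; apply: lerD.
    apply: le_trans (prob_over _ _ _ _ (calibrated_reward nobd pmin0 _) (ltW d4)) _.
    by rewrite mulrAC.
  apply: le_trans (prob_hitU _ _ _ _ _) _; apply: lerD.
    apply: le_trans (prob_under _ _ _ _ (calibrated_value pmin0 _ _) _) _.
      by rewrite divr_ge0 // ltW.
    by rewrite mulrAC.
  apply: le_trans (prob_under _ _ _ _ (calibrated_reward nobd pmin0 _) _) _.
    by rewrite mulr_ge0 // ltW.
  by rewrite ler_expR lerN2 le_eqVlt; apply/orP; left; apply/eqP; ring.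
rewrite !big_split /=; apply: lerD; first apply: lerD; apply: sum_expR_le.
- by rewrite divr_gt0 // exprn_gt0.
- by rewrite divr_gt0 // exprn_gt0 // divr_gt0.
- by rewrite mulr_gt0 ?divr_gt0 // exprn_gt0 // mulr_gt0.
Qed.

(** Half of d0 is lost only if mu_0 is overestimated by d0 / 4 or the best intervention
    underestimated by gamma d0 / 4. The latter has at least p / 2 samples per observation, unless
    its value is too rare among the observations. *)
Lemma bad_obsP h : reach h -> (init_rounds I <= size h)%N ->
  gap_hat h < d0 / 2 -> bad_obs (pulls obs_arm h) h.
Proof.
move=> rh sz gh.
have g0 : 0 < gamma I := lt_le_trans ltr01 gamma1.
have s0 := samples_gt0 crm _ rh sz.
rewrite /bad_obs /=; apply/or3P.
have [H0|H0] := leP (mu (obs_arm : arm I) + d0 / 4) (mu_hat obs_arm h).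
  by apply: Or31; apply: (mu_hat_over rh) => //; rewrite -samples_obs.
have [HF|HF] := leP (count (predI (@obs_round R I) (obs_value istar xstar)) h)%:R (p / 2 * (pulls obs_arm h)%:R).
  apply: Or32; rewrite /undershoots /= -pulls_obsE lexx /=.
  by apply: le_trans HF _; rewrite ler_wpM2r //; lra.
apply: Or33; apply: (mu_hat_under rh) => //.
  by apply: le_trans (ltW HF) _; rewrite ler_nat samples_do leq_addl.
apply: le_trans (mu_hat_max_ge _ _ _) _.
move: gh; rewrite /gap_hat => gh.
have : mu_hat_max h / gamma I <= v - d0 / 4.
  by rewrite /value_gap value_obs in H0 gh *; lra.
rewrite ler_pdivrMr // mulrBl -/(cost astar) -muE; lra.
Qed.

(** Every such observation uses 1 of a remaining budget that is already below gamma. *)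
Lemma steps_last h : reach h ->
  (steps (fun a g => (a == None) && (B - spent g < gamma I)) h)%:R <=
  Num.max 0 (gamma I - (B - spent h)).
Proof.
elim=> [|g a w rg IH Ea ca] /=; first by rewrite le_max lexx.
have c1 := cost_ge1 gamma1 a.
move: IH; rewrite natrD !le_max spent_cons /= => /orP[IH|IH].
  case: eqVneq => ae /=; last by apply/orP; left; lra.
  case: ltP => lg /=; last by apply/orP; left; lra.
  by apply/orP; right; lra.
apply/orP; right.
apply: le_trans (_ : 1 + (gamma I - (B - spent g)) <= _); last by lra.
by apply: lerD => //; rewrite lern1 leq_b1.
Qed.

Lemma lnB_ge0 : 0 <= ln B.
Proof. by rewrite ln_ge0 // (B_ge1 gamma1 budget). Qed.

Lemma ln_size_le h : reach h -> ln (size h)%:R <= ln B.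
Proof.
move=> rh; case: (posnP (size h)) => [->|s0]; first by rewrite ln0 // lnB_ge0.
rewrite ler_ln ?posrE ?ltr0n // ?(size_le_B gamma1 budget rh) //.
exact: lt_le_trans ltr01 (B_ge1 gamma1 budget).
Qed.

Lemma ln_sizeS_le h a : reach h -> alg h = Some a -> cost a <= B - spent h ->
  ln (size h).+1%:R <= ln B.
Proof.
move=> rh Ea ca.
have w : assignment (network I) := [ffun u => Ordinal (range_size_gt0 u)].
exact: (ln_size_le (reach_cons w rh Ea ca)).
Qed.

(** Beyond 32 ln B / d0^2 observations, a forced one needs beta^2 > 8 / (d0 / 2)^2, hence an
    estimated gap below d0 / 2. One chosen by its index has radius at most d0 / 2, so mu_0 is
    overestimated or the index of the best arm is below its value. *)
Lemma obs_step h a : reach h -> alg h = Some a -> cost a <= B - spent h -> a == None ->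
  [|| (size h < init_rounds I)%N, (pulls obs_arm h)%:R < 32 / d0 ^+ 2 * ln B,
      B - spent h < gamma I, low_ucb astar (size h) h | bad_obs (pulls obs_arm h) h].
Proof.
move=> rh Ea ca a0; have [K|K] := ltP _ (32 / d0 ^+ 2 * ln B); first by rewrite orbT.
have d01 := gap0_le1; have d0p : 0 < d0 := gap0.
have E32 : 8 / (d0 / 2) ^+ 2 = 32 / d0 ^+ 2.
  by field; rewrite gt_eqF.
case: (stepP crm Ea) => [->//|sz _ F|_ _ -> |sz _ U].
- rewrite bad_obsP ?orbT //; apply: beta_large_gap; first by lra.
  have L := ln_sizeS_le rh Ea ca.
  have L0 := ln_ge0_nat R (size h).+1.
  rewrite E32; have := lt_le_trans F (lexx _); have := le_lt_trans K F.
  set s := ln _ in L L0 *; set c := 32 / d0 ^+ 2; set bb := beta h ^+ 2.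
  have c0 : 0 <= c by rewrite divr_ge0 ?sqr_ge0.
  move=> H _; rewrite ltNge; apply/negP => bc.
  have : bb * s <= c * ln B by rewrite (le_trans (ler_wpM2r L0 bc)) // ler_wpM2l.
  lra.
- by rewrite !orbT.
have [lo|lo] := ltP (ucb astar h) v; first by rewrite (low_ucbP gamma1 crm) ?orbT.
suff H : bad_obs (pulls obs_arm h) h by rewrite H !orbT.
rewrite /bad_obs /=; apply/or3P; apply: Or31.
have s0 := samples_gt0 crm obs_arm rh sz.
apply: (mu_hat_over rh) => //; first by rewrite -samples_obs.
have := le_trans lo (U astar); rewrite (eqP a0 : a = obs_arm) {1}/ucb divr1.
have : Num.sqrt (8 * ln (size h)%:R / (samples obs_arm h)%:R) <= d0 / 2.
  rewrite -[X in _ <= X](@gtr0_norm _ (d0 / 2)) ?divr_gt0 // -sqrtr_sqr ler_sqrt ?sqr_ge0 //.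
  rewrite ler_pdivrMr ?ltr0n //.
  have L := ln_size_le rh; rewrite samples_obs.
  have := ler_wpM2l (sqr_ge0 (d0 / 2)) K.
  have -> : (d0 / 2) ^+ 2 * (32 / d0 ^+ 2 * ln B) = 8 * ln B.
    by field; rewrite gt_eqF.
  lra.
have : v = mu (obs_arm : arm I) + d0 by rewrite /value_gap value_obs; ring.
lra.
Qed.

Lemma expect_obs_pulls :
  expect alg B (fun g => (pulls obs_arm g)%:R) horizon [::] <=
  32 / d0 ^+ 2 * ln B + ((init_rounds I)%:R + gamma I + 4 + bad_obs_total).
Proof.
(* One class for each alternative of [obs_step]: [P1], [P2] and [P3] are bounded on every run, [P4]
   and [P5] in expectation. *)
pose P1 a g := (a == None :> arm I) && ((size g)%:R < (init_rounds I)%:R :> R).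
pose P2 a g := (a == None :> arm I) && ((pulls obs_arm g)%:R < 32 / d0 ^+ 2 * ln B).
pose P3 a g := (a == None :> arm I) && (B - spent g < gamma I).
pose P4 a g := (a == None :> arm I) && low_ucb astar (size g) g.
pose P5 a g := (a == None :> arm I) && bad_obs (pulls obs_arm g) g.
have K0 : 0 <= 32 / d0 ^+ 2 * ln B by rewrite mulr_ge0 ?lnB_ge0 // divr_ge0 ?sqr_ge0.
apply: le_trans (_ : expect alg B (fun g => (32 / d0 ^+ 2 * ln B + ((init_rounds I)%:R + gamma I + 2)) +
   ((steps P4 g)%:R + (steps P5 g)%:R)) horizon [::] <= _).
  apply: expect_le' => g rg.
  have H : (pulls obs_arm g <= steps P1 g + (steps P2 g + (steps P3 g + (steps P4 g + steps P5 g))))%N.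
    rewrite pulls_steps.
    apply: (@leq_trans (steps (fun a h => P1 a h || (P2 a h || (P3 a h || (P4 a h || P5 a h)))) g)); last first.
      do 3! (apply: leq_trans (stepsU _ _ _) _; rewrite leq_add2l).
      exact: stepsU.
    apply: (steps_le rg) => a h rh Ea ca a0.
    have := obs_step rh Ea ca a0; rewrite /P1 /P2 /P3 /P4 /P5 a0 /= ltr_nat.
    by [].
  have H1 : (steps P1 g)%:R <= (init_rounds I)%:R + 1 :> R.
    by apply: (steps_lt_bound g (indexing_size _)).
  have H2 : (steps P2 g)%:R <= 32 / d0 ^+ 2 * ln B + 1.
    apply: (steps_lt_bound (P := fun a _ => a == None) g _ K0).
    by apply: indexing_pulls.
  have H3 : (steps P3 g)%:R <= gamma I.
    apply: le_trans (steps_last rg) _.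
    have := spent_le gamma1 budget rg; have g1 := gamma1; rewrite ge_max => s; apply/andP; split; lra.
  have : (pulls obs_arm g)%:R <= (steps P1 g)%:R + ((steps P2 g)%:R + ((steps P3 g)%:R +
      ((steps P4 g)%:R + (steps P5 g)%:R))) :> R by rewrite -!natrD ler_nat.
  lra.
rewrite expectD expect_cst expectD.
have H4 : expect alg B (fun g => (steps P4 g)%:R) horizon [::] <= 2.
  have := @expect_steps R I gamma1 alg B budget (fun a _ => a == None) (fun g => size g) (low_ucb astar) (indexing_size _) (fun _ _ => leqnn _).
  move=> H; apply: le_trans H _; apply: le_trans (sum_inv_sqr_le R horizon).
  by apply: ler_sum => k _; apply: prob_low_ucb.
have H5 : expect alg B (fun g => (steps P5 g)%:R) horizon [::] <= bad_obs_total.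
  apply: le_trans (prob_bad_obs horizon horizon).
  apply: (@expect_steps R I gamma1 alg B budget (fun a _ => a == None) (pulls obs_arm) bad_obs) => [|h _].
    exact: indexing_pulls.
  exact: count_size.
lra.
Qed.

End Exploration.

(** * Pulls of inferior interventions *)

Section Interventions.
Context (R : realType) (I : causal_bandit R).
Implicit Types (h g : history I) (a b : arm I) (n : nat) (r : round I) (i : 'I_(M I)) (x : bool).

Hypothesis nobd : no_backdoor I.
Hypothesis gamma1 : 1 <= gamma I.
Hypothesis pmin0 : 0 < prob_min I.
Variables (istar : 'I_(M I)) (xstar : bool).
Local Notation astar := (do_arm istar xstar).
Local Notation v := (value astar).
Local Notation d0 := (value_gap astar obs_arm).
Hypothesis gap0 : 0 < d0.
Hypothesis best : forall b, value b <= v.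

Definition obs_share i x h : R := (count (predI (@obs_round R I) (obs_value i x)) h)%:R.

Definition deviates_do (m : R) (ix : 'I_(M I) * bool) : pred (history I) :=
  let a := do_arm ix.1 ix.2 in let q := prob ix.1 ix.2 in
  predU (undershoots (@obs_round R I) (obs_value ix.1 ix.2) q (q / 10) m)
  (predU (overshoots (informative a) (@rewarded R I) (mu a) (d0 / 20) (q / 2 * m))
  (undershoots (informative a) (@rewarded R I) (mu a) (d0 / 20) (q / 2 * m))).

(** Finer than [bad_obs]: the estimated gap has to be known up to d0 / 10, and as it involves the
    maximum over all interventions, each of them is watched. *)
Definition deviates (m : R) : pred (history I) :=
  predU (overshoots (informative obs_arm) (@rewarded R I) (mu (obs_arm : arm I)) (d0 / 20) m)
  (predU (undershoots (informative obs_arm) (@rewarded R I) (mu (obs_arm : arm I)) (d0 / 20) m)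
   (fun h => has (fun ix => deviates_do m ix h) (enum {: 'I_(M I) * bool}))).

Definition gap_ok i x h : bool :=
  [&& 0 < gap_hat h, gap_hat h <= 11 / 10 * d0
    & 9 / 10 * prob i x * (pulls obs_arm h)%:R <= obs_share i x h].

(** A common lower bound for the exponents per observation: (d0 / 20)^2 / 2 per sample with q / 2
    samples per observation gives d0^2 q / 1600, and the frequencies give (q / 10)^2 / 2; d0 and q
    are at most 1. *)
Definition deviation_rate : R := (d0 * prob_min I) ^+ 2 / 1600.

Lemma deviation_rate_gt0 : 0 < deviation_rate.
Proof. by rewrite divr_gt0 // exprn_gt0 // mulr_gt0. Qed.

Variables (alg : algorithm I) (B : R).
Hypothesis budget : 2 * gamma I * (M I)%:R + 1 <= B.
Hypothesis crm : crm_nb_alg B alg.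
Local Notation reach := (reach alg B).
Local Notation horizon := (Num.truncn B).

Lemma prob_deviates n m : 0 <= m -> prob_hit alg B n (deviates m) <=
  (2 + 3 * #|{: 'I_(M I) * bool}|%:R) * expR (- (deviation_rate * m)).
Proof.
move=> m0; set e := expR _.
have d1 := gap0_le1 nobd gamma1 pmin0 istar xstar.
have d0p : 0 < d0 := gap0.
have d20 : 0 <= d0 / 20 by rewrite divr_ge0 // ltW.
have pm1 : prob_min I <= 1 := le_trans (prob_min_le istar xstar) (prob_le1 istar xstar).
have pmp : 0 < prob_min I := pmin0.
have eE (c : R) : deviation_rate <= c -> expR (- (c * m)) <= e.
  by move=> ce; rewrite ler_expR lerN2 ler_wpM2r.
have rate (q : R) : prob_min I <= q -> q <= 1 -> deviation_rate <= (d0 / 20) ^+ 2 / 2 * (q / 2).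
  move=> pq q1; rewrite /deviation_rate.
  have -> : (d0 / 20) ^+ 2 / 2 * (q / 2) = d0 ^+ 2 * q / 1600 by field.
  rewrite ler_pM2r ?invr_gt0 // exprMn ler_wpM2l ?sqr_ge0 //; apply: le_trans pq.
  by rewrite expr2 ler_piMl // ltW.
have rate1 : deviation_rate <= (d0 / 20) ^+ 2 / 2.
  apply: le_trans (rate 1 pm1 (lexx _)) _; rewrite ler_piMr //; last by lra.
  by rewrite divr_ge0 // sqr_ge0.
have rate2 (q : R) : prob_min I <= q -> deviation_rate <= (q / 10) ^+ 2 / 2.
  move=> pq; rewrite /deviation_rate.
  have -> : (q / 10) ^+ 2 / 2 = 8 * q ^+ 2 / 1600 by field.
  rewrite ler_pM2r ?invr_gt0 // exprMn.
  have h1 : d0 ^+ 2 <= 1 by rewrite exprn_ile1 // ltW.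
  have h2 : prob_min I ^+ 2 <= q ^+ 2 by rewrite ler_pXn2r ?nnegrE //; [exact: ltW|exact: le_trans (ltW pmp) pq].
  have h3 := sqr_ge0 (prob_min I).
  have := ler_wpM2r h3 h1; lra.
apply: le_trans (prob_hitU _ _ _ _ _) _.
have -> : (2 + 3 * #|{: 'I_(M I) * bool}|%:R) * e = e + (e + \sum_(ix : 'I_(M I) * bool) (e + (e + e))).
  rewrite sumr_const -[X in _ = _ + (_ + X)]mulr_natl; ring.
apply: lerD.
  apply: le_trans (prob_over _ _ _ _ (calibrated_reward nobd pmin0 _) d20) _.
  by rewrite mulrAC; exact: eE.
apply: le_trans (prob_hitU _ _ _ _ _) _; apply: lerD.
  apply: le_trans (prob_under _ _ _ _ (calibrated_reward nobd pmin0 _) d20) _.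
  by rewrite mulrAC; exact: eE.
apply: le_trans (prob_hit_has _ _ _ _ _) _; rewrite big_enum /=.
apply: ler_sum => -[i x] _; have pp := prob_gt0 pmin0 i x.
have pp1 := @prob_le1 R I i x; have pmi := @prob_min_le R I i x.
apply: le_trans (prob_hitU _ _ _ _ _) _; apply: lerD.
  apply: le_trans (prob_under _ _ _ _ (calibrated_value pmin0 _ _) _) _ => /=.
    by rewrite divr_ge0 // ltW.
  by rewrite mulrAC; apply/eE/rate2.
apply: le_trans (prob_hitU _ _ _ _ _) _; apply: lerD.
  apply: le_trans (prob_over _ _ _ _ (calibrated_reward nobd pmin0 _) d20) _ => /=.
  rewrite (_ : _ * _ / 2 = (d0 / 20) ^+ 2 / 2 * (prob i x / 2) * m); last by ring.
  exact/eE/rate.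
apply: le_trans (prob_under _ _ _ _ (calibrated_reward nobd pmin0 _) d20) _ => /=.
rewrite (_ : _ * _ / 2 = (d0 / 20) ^+ 2 / 2 * (prob i x / 2) * m); last by ring.
exact/eE/rate.
Qed.

(** As no value exceeds v and gamma >= 1, the estimate of v is within d0 / 20 of it; so is that of
    mu_0, and the estimated gap is within d0 / 10 of d0. *)
Lemma deviatesP m h i x : reach h -> (init_rounds I <= size h)%N -> 0 <= m ->
  m <= (pulls obs_arm h)%:R -> ~~ deviates m h -> gap_ok i x h.
Proof.
move=> rh sz m0 mN.
have d0p : 0 < d0 := gap0.
have g0 : 0 < gamma I := lt_le_trans ltr01 gamma1.
have s0 a := samples_gt0 crm a rh sz.
rewrite /deviates /= !negb_or => /and3P[D1 D2 /hasPn D3].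
have {}D1 : mu_hat obs_arm h < mu (obs_arm : arm I) + d0 / 20.
  by rewrite ltNge; apply: contra D1 => H; apply: (mu_hat_over rh) => //; rewrite samples_obs.
have {}D2 : mu (obs_arm : arm I) - d0 / 20 < mu_hat obs_arm h.
  by rewrite ltNge; apply: contra D2 => H; apply: (mu_hat_under rh) => //; rewrite samples_obs.
have F j y : 9 / 10 * prob j y * (pulls obs_arm h)%:R <= obs_share j y h.
  have := D3 (j, y); rewrite mem_enum /deviates_do /= !negb_or => /(_ isT) /andP[H _].
  apply: ltW; rewrite ltNge; apply: contra H => H; rewrite /undershoots -pulls_obsE mN /=.
  by apply: le_trans H _; rewrite ler_wpM2r //; lra.
have S j y : prob j y / 2 * m <= (samples (do_arm j y) h)%:R.
  apply: le_trans (_ : obs_share j y h <= _); last by rewrite ler_nat samples_do leq_addl.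
  apply: le_trans (F j y); have pp := prob_gt0 pmin0 j y.
  apply: le_trans (_ : prob j y / 2 * (pulls obs_arm h)%:R <= _).
    by rewrite ler_wpM2l // divr_ge0 // ltW.
  by rewrite ler_wpM2r //; lra.
have U j y : mu_hat (do_arm j y) h < mu (do_arm j y) + d0 / 20.
  have := D3 (j, y); rewrite mem_enum /deviates_do /= !negb_or => /(_ isT) /and3P[_ H _].
  by rewrite ltNge; apply: contra H => H; apply: (mu_hat_over rh).
have L : mu astar - d0 / 20 < mu_hat astar h.
  have := D3 (istar, xstar); rewrite mem_enum /deviates_do /= !negb_or => /(_ isT) /and3P[_ _ H].
  by rewrite ltNge; apply: contra H => H; apply: (mu_hat_under rh).
have muv a : mu a = value a * cost a := muE gamma1 a.
have dE : d0 = v - mu (obs_arm : arm I) by rewrite /value_gap value_obs.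
have g1 : 1 <= gamma I := gamma1.
have v0 : 0 <= v.
  by rewrite /value divr_ge0 ?(mu_ge0 nobd pmin0) // (le_trans ler01 (cost_ge1 gamma1 _)).
rewrite /gap_ok F andbT; apply/andP; split.
  have : v - d0 / 20 < mu_hat_max h / gamma I.
    rewrite ltr_pdivlMr //; apply: lt_le_trans (mu_hat_max_ge istar xstar h).
    apply: le_lt_trans L; rewrite muv mulrBl lerB // ler_peMr //; lra.
  by rewrite /gap_hat; lra.
have : mu_hat_max h / gamma I <= v + d0 / 20.
  rewrite ler_pdivrMr //; apply: mu_hat_max_le => [|j y]; first by rewrite mulr_ge0 ?(ltW g0) //; lra.
  apply: le_trans (ltW (U j y)) _; rewrite muv [X in _ <= X]mulrDl; apply: lerD.
    by apply: ler_wpM2r; [exact: ltW|exact: best].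
  by rewrite ler_peMr //; lra.
by rewrite /gap_hat; lra.
Qed.

(* The number of observations is at least m from this round on. *)
Definition settle_time (m : R) : nat :=
  (maxn (init_rounds I) (Num.truncn (expR m)).+1 + (Num.truncn m).+1)%N.

Lemma settle_time_init m : (init_rounds I < settle_time m)%N.
Proof. by rewrite /settle_time; lia. Qed.

Lemma ln_settle_time m n : (settle_time m <= n)%N -> m <= ln n%:R.
Proof.
move=> mn; have e0 : 0 <= expR m := expR_ge0 m.
rewrite -[m]expRK ler_ln ?posrE ?expR_gt0 ?ltr0n //; last first.
  by apply: leq_trans mn; rewrite /settle_time; lia.
apply: ltW; rewrite -truncn_lt_nat //; apply: leq_trans mn; rewrite /settle_time; lia.
Qed.

Lemma pulls_settle_time m h : reach h -> 0 <= m -> (settle_time m <= size h)%N ->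
  m <= (pulls obs_arm h)%:R.
Proof.
(* From round [s0] on, ln t >= m: observations are forced until there are m of them, which takes at
   most [(Num.truncn m).+1] more rounds. *)
move=> rh m0 mh; set s0 := maxn (init_rounds I) (Num.truncn (expR m)).+1.
have ls0 : m <= ln s0%:R.
  rewrite -[m]expRK ler_ln ?posrE ?expR_gt0 ?ltr0n //; last by rewrite /s0; lia.
  by apply: ltW; rewrite -truncn_lt_nat ?expR_ge0 // /s0; lia.
have s0i : (init_rounds I <= s0)%N by rewrite /s0; lia.
have := obs_growth gamma1 pmin0 budget crm rh s0i ls0.
have -> // : Num.min m ((size h)%:R - s0%:R) = m.
rewrite min_l // lerBrDl; apply: le_trans (_ : s0%:R + (Num.truncn m).+1%:R <= _).
  by rewrite lerD2l ltW // -truncn_lt_nat.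
by rewrite -natrD ler_nat.
Qed.

Variables (j : 'I_(M I)) (y : bool).
Local Notation b := (do_arm j y).
Local Notation gapb := (mean_gap astar b).
Hypothesis gapb0 : 0 < gapb.

Definition unsettled m : pred (history I) := fun h =>
  (settle_time m <= size h)%N && ~~ gap_ok j y h.

Lemma prob_unsettled n m : 0 <= m -> prob_hit alg B n (unsettled m) <=
  (2 + 3 * #|{: 'I_(M I) * bool}|%:R) * expR (- (deviation_rate * m)).
Proof.
move=> m0; apply: le_trans (prob_deviates n m0); apply: prob_hit_le => h rh /andP[sz].
apply: contraNT => D; apply: (deviatesP j y rh _ m0) => //.
  exact: ltnW (leq_trans (settle_time_init m) sz).
exact: pulls_settle_time.
Qed.

(** With 16 ln t / gapb^2 samples the radius is gapb / sqrt 2 < 3/4 gapb, which leaves gapb / 4 for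
    the deviation in [overestimated]. *)
Definition rate_ucb : R := 16 / gapb ^+ 2.
(* The observations needed for beta ^+ 2 ~ 8 / d0 ^+ 2 come with a share
   prob j y of samples of the arm; the slack 8 > 16 / 3 absorbs the errors. *)
Definition rate_net : R := Num.max 0 (rate_ucb - 16 * prob j y / (3 * d0 ^+ 2)).

Definition overestimated (n : nat) : pred (history I) :=
  overshoots (informative b) (@rewarded R I) (mu b) (gapb / 4) n%:R.

(** Without deviations, b is pulled only while it has fewer than [rate_ucb] ln t samples. Once
    settled, these include its share of the observations forced by beta, and fewer than [rate_net]
    ln t remain for actual pulls. *)
Lemma do_step m h a : 8 / d0 ^+ 2 <= m ->
  reach h -> alg h = Some a -> cost a <= B - spent h -> a == b ->
  [|| (size h < settle_time m)%N, low_ucb astar (size h) h, overestimated (pulls b h) h |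
   ((pulls b h)%:R < rate_ucb * ln B) &&
   (unsettled m h || ((pulls b h)%:R < rate_net * ln B))].
Proof.
move=> m8 rh Ea ca /eqP ab; rewrite ab in Ea.
have [//|sz] := ltnP (size h) (settle_time m).
have szi := leq_trans (settle_time_init m) sz.
case: (stepP crm Ea) => [s|//|//|_ F U]; first by move: szi; rewrite ltnNge (ltnW s).
have d0p : 0 < d0 := gap0.
have Dp : 0 < gapb := gapb0.
have g0 : 0 < gamma I := lt_le_trans ltr01 gamma1.
have [lo|lo] := ltP (ucb astar h) v; first by rewrite (low_ucbP gamma1 crm rh) ?orbT // ltnW.
have s0 := samples_gt0 crm b rh (ltnW szi).
have L := ln_size_le gamma1 budget rh.
have L0 := ln_ge0_nat R (size h).
have [sb|sb] := leP (rate_ucb * ln (size h)%:R) (samples b h)%:R.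
  apply/or4P; apply: Or43.
  apply: (mu_hat_over rh) => //; first by rewrite ler_nat pulls_samples.
  have := le_trans lo (U astar).
  rewrite {1}/ucb /value ler_pM2r ?invr_gt0 //.
  have : Num.sqrt (8 * ln (size h)%:R / (samples b h)%:R) <= 3 / 4 * gapb.
    have D34 : 0 < 3 / 4 * gapb by rewrite mulr_gt0 // divr_gt0.
    rewrite -[X in _ <= X](gtr0_norm D34) -sqrtr_sqr ler_sqrt ?sqr_ge0 //.
    rewrite ler_pdivrMr ?ltr0n //.
    have := ler_wpM2l (sqr_ge0 gapb) sb.
    have -> : gapb ^+ 2 * (rate_ucb * ln (size h)%:R) = 16 * ln (size h)%:R.
      by rewrite /rate_ucb mulrA mulrCA mulfV ?mulr1 // expf_neq0 // gt_eqF.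
    have -> : (3 / 4 * gapb) ^+ 2 * (samples b h)%:R = 9 / 16 * (gapb ^+ 2 * (samples b h)%:R) by field.
    move=> H; have := ler_wpM2l (_ : 0 <= 9 / 16) H; lra.
  by rewrite /mean_gap; lra.
apply/or4P; apply: Or44; apply/andP; split.
  apply: le_lt_trans (_ : (samples b h)%:R < _); first by rewrite ler_nat pulls_samples.
  by apply: lt_le_trans sb _; rewrite ler_wpM2l // divr_ge0 ?sqr_ge0.
have [/and3P[gh0 gh1 sh]|nok] := boolP (gap_ok j y h); last by rewrite /unsettled sz nok.
apply/orP; right.
(* 8 / (11/10)^2 > 6, and after the settling time the cap ln t on beta^2 is at least m >= 8 /
   d0^2. *)
have b6 : 6 / d0 ^+ 2 <= beta h ^+ 2.
  rewrite beta_gap // le_min; apply/andP; split.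
    rewrite ler_pdivrMr ?exprn_gt0 // mulrAC ler_pdivlMr ?exprn_gt0 //.
    have : gap_hat h ^+ 2 <= (11 / 10 * d0) ^+ 2.
      by rewrite ler_pXn2r ?nnegrE //; apply: ltW => //; rewrite mulr_gt0 // divr_gt0.
    have := sqr_ge0 d0; rewrite exprMn; lra.
  apply: le_trans (ln_settle_time sz); apply: le_trans m8.
  by rewrite ler_pM2r ?invr_gt0 ?exprn_gt0 // ler_nat.
have N6 : 6 / d0 ^+ 2 * ln (size h)%:R <= (pulls obs_arm h)%:R.
  apply: le_trans F; apply: ler_pM => //; first by rewrite divr_ge0 ?sqr_ge0.
  by rewrite ler_ln ?posrE ?ltr0n ?ler_nat //; apply: leq_ltn_trans szi.
have pp := prob_gt0 pmin0 j y.
(* 9/10 of 6 is 5.4, which is at least 16/3. *)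
have Sh : 16 * prob j y / (3 * d0 ^+ 2) * ln (size h)%:R <= obs_share j y h.
  apply: le_trans sh; have c0 : 0 <= 9 / 10 * prob j y by rewrite mulr_ge0 ?divr_ge0 // ltW.
  apply: le_trans (ler_wpM2l c0 N6).
  have -> : 16 * prob j y / (3 * d0 ^+ 2) * ln (size h)%:R =
     16 / 3 * (prob j y / d0 ^+ 2 * ln (size h)%:R) by field; rewrite gt_eqF.
  have -> : 9 / 10 * prob j y * (6 / d0 ^+ 2 * ln (size h)%:R) =
     54 / 10 * (prob j y / d0 ^+ 2 * ln (size h)%:R) by field; rewrite gt_eqF.
  rewrite ler_wpM2r //; last by lra.
  by rewrite mulr_ge0 // divr_ge0 ?sqr_ge0 // ltW.
have K : (pulls b h)%:R < (rate_ucb - 16 * prob j y / (3 * d0 ^+ 2)) * ln (size h)%:R.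
  by move: sb; rewrite samples_do natrD -/(obs_share j y h) mulrBl; lra.
apply: lt_le_trans K _; apply: le_trans (_ : rate_net * ln (size h)%:R <= _).
  by rewrite ler_wpM2r // /rate_net le_max lexx orbT.
by rewrite ler_wpM2l // /rate_net le_max lexx.
Qed.

(** Runs that are ever unsettled pay the cruder [rate_ucb], weighted by their probability, which is
    small for large m; the others pay [rate_net]. *)
Lemma expect_do_pulls m : 8 / d0 ^+ 2 <= m ->
  expect alg B (fun g => (pulls b g)%:R) horizon [::] <=
  rate_net * ln B + rate_ucb * ln B * prob_hit alg B horizon (unsettled m) +
  ((settle_time m)%:R + 4 + geom_sum ((gapb / 4) ^+ 2 / 2)).
Proof.
move=> m8; have LB := lnB_ge0 gamma1 budget.
pose P1 a g := (a == b :> arm I) && ((size g)%:R < (settle_time m)%:R :> R).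
pose P2 a g := (a == b :> arm I) && low_ucb astar (size g) g.
pose P3 a g := (a == b :> arm I) && overestimated (pulls b g) g.
pose P4 a g := (a == b :> arm I) && (((pulls b g)%:R < rate_ucb * ln B) &&
   (unsettled m g || ((pulls b g)%:R < rate_net * ln B))).
have ru0 : 0 <= rate_ucb by rewrite divr_ge0 ?sqr_ge0.
have rn0 : 0 <= rate_net by rewrite le_max lexx.
have ix : indexing (fun a _ => a == b) (pulls b) by exact: indexing_pulls.
apply: le_trans (_ : expect alg B (fun g =>
   (rate_net * ln B + ((settle_time m)%:R + 2)) +
   (rate_ucb * ln B * (hit (unsettled m) g)%:R +
   ((steps P2 g)%:R + (steps P3 g)%:R))) horizon [::] <= _).
  apply: expect_le' => g rg.
  have H : (pulls b g <= steps P1 g + (steps P2 g + (steps P3 g + steps P4 g)))%N.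
    rewrite pulls_steps.
    apply: (@leq_trans (steps (fun a h => P1 a h || (P2 a h || (P3 a h || P4 a h))) g)); last first.
      do 2! (apply: leq_trans (stepsU _ _ _) _; rewrite leq_add2l).
      exact: stepsU.
    apply: (steps_le rg) => a h rh Ea ca ab.
    have := do_step m8 rh Ea ca ab; rewrite /P1 /P2 /P3 /P4 ab /= ltr_nat.
    by [].
  have H1 : (steps P1 g)%:R <= (settle_time m)%:R + 1 :> R.
    by apply: (steps_lt_bound g (indexing_size _)).
  have H4 : (steps P4 g)%:R <= rate_net * ln B + 1 + rate_ucb * ln B * (hit (unsettled m) g)%:R.
    have bnd (K : R) : 0 <= K -> (steps (fun a h => (a == b) && ((pulls b h)%:R < K)) g)%:R <= K + 1.
      move=> K0; exact: (steps_lt_bound (P := fun a _ => a == b) g ix K0).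
    have h1 : 0 <= rate_ucb * ln B by rewrite mulr_ge0.
    have h2 : 0 <= rate_net * ln B by rewrite mulr_ge0.
    case: (boolP (hit (unsettled m) g)) => hg.
      rewrite mulr1; apply: le_trans (_ : rate_ucb * ln B + 1 <= _); last by lra.
      apply: le_trans (bnd _ h1); rewrite ler_nat; apply: (steps_le rg) => a h _ _ _.
      by rewrite /P4 => /and3P[-> ->].
    rewrite mulr0 addr0 (steps_notin _ hg).
    apply: le_trans (bnd _ h2); rewrite ler_nat; apply: (steps_le rg) => a h _ _ _.
    by rewrite /P4 => /andP[/and3P[-> _ /orP[->|->]]].
  have : (pulls b g)%:R <= (steps P1 g)%:R + ((steps P2 g)%:R + ((steps P3 g)%:R +
      (steps P4 g)%:R)) :> R by rewrite -!natrD ler_nat.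
  lra.
rewrite expectD expect_cst expectD expectZ expectD.
have H2 : expect alg B (fun g => (steps P2 g)%:R) horizon [::] <= 2.
  have := @expect_steps R I gamma1 alg B budget (fun a _ => a == b) (fun g => size g) (low_ucb astar) (indexing_size _) (fun _ _ => leqnn _).
  move=> H; apply: le_trans H _; apply: le_trans (sum_inv_sqr_le R horizon).
  by apply: ler_sum => k _; apply: prob_low_ucb.
have H3 : expect alg B (fun g => (steps P3 g)%:R) horizon [::] <= geom_sum ((gapb / 4) ^+ 2 / 2).
  have D0 : 0 < gapb / 4 by rewrite divr_gt0.
  apply: le_trans (sum_expR_le horizon _); last by rewrite divr_gt0 // exprn_gt0.
  apply: le_trans (_ : \sum_(k < horizon) prob_hit alg B horizon (overestimated k) <= _).
    apply: (@expect_steps R I gamma1 alg B budget (fun a _ => a == b) (pulls b) overestimated ix).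
    by move=> h _; exact: count_size.
  apply: ler_sum => k _; apply: le_trans (prob_over _ _ _ _ (calibrated_reward nobd pmin0 _) (ltW D0)) _.
  by rewrite mulrAC.
rewrite -/(prob_hit alg B horizon (unsettled m)); lra.
Qed.

End Interventions.

(** * Regret when an intervention is best *)

Section InterventionBest.
Context (R : realType) (I : causal_bandit R).
Hypothesis nobd : no_backdoor I.
Hypothesis gamma1 : 1 <= gamma I.
Hypothesis pmin0 : 0 < prob_min I.
Variables (istar : 'I_(M I)) (xstar : bool).
Local Notation astar := (do_arm istar xstar).
Local Notation v := (value astar).
Local Notation d0 := (value_gap astar obs_arm).
Local Notation gap ix := (mean_gap astar (do_arm ix.1 ix.2)).
Hypothesis best : forall b : arm I, value b <= v.
Hypothesis gap0 : 0 < d0.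

Lemma mean_gapE i x : mean_gap astar (do_arm i x) = gamma I * value_gap astar (do_arm i x).
Proof. by rewrite /mean_gap /value_gap !(muE gamma1) /=; ring. Qed.

Lemma obs_gap_le : d0 <= mean_gap astar obs_arm.
Proof.
rewrite /mean_gap /value_gap value_obs lerD2r (muE gamma1) ler_peMr //.
by rewrite /value divr_ge0 ?(mu_ge0 nobd pmin0) // (le_trans ler01 (cost_ge1 gamma1 _)).
Qed.

(** The mean gap is gamma times the value gap, hence not smaller; 16 being twice 8 yields the factor
    2. *)
Lemma rate_net_le i x (L : R) : 0 <= L -> 0 < mean_gap astar (do_arm i x) ->
  rate_net istar xstar i x * L <= 2 * Num.max 0 (1 + 8 * L *
    (1 / value_gap astar (do_arm i x) ^+ 2 - prob i x / (3 * d0 ^+ 2))).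
Proof.
move=> L0; rewrite /rate_net /rate_ucb mean_gapE.
set w := value_gap astar (do_arm i x); set q := prob i x.
have g1 : 1 <= gamma I := gamma1; have d0p : 0 < d0 := gap0.
have g0 : 0 < gamma I by lra.
rewrite pmulr_rgt0 // => w0.
have h1 : 16 / (gamma I * w) ^+ 2 <= 16 / w ^+ 2.
  rewrite ler_pM2l // lef_pV2 ?posrE ?exprn_gt0 ?mulr_gt0 //.
  have w0' := ltW w0; rewrite ler_pXn2r ?nnegrE ?mulr_ge0 ?(ltW g0) //.
  by rewrite ler_peMl.
have [k|k] := leP 0 (16 / (gamma I * w) ^+ 2 - 16 * q / (3 * d0 ^+ 2)); last first.
  by rewrite mul0r mulr_ge0 // le_max lexx.
apply: le_trans (_ : 2 * (1 + 8 * L * (1 / w ^+ 2 - q / (3 * d0 ^+ 2))) <= _); last first.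
  by rewrite ler_wpM2l // le_max lexx orbT.
have := ler_wpM2r L0 h1.
have -> : 2 * (1 + 8 * L * (1 / w ^+ 2 - q / (3 * d0 ^+ 2))) =
  2 + (16 / w ^+ 2 * L - 16 * q / (3 * d0 ^+ 2) * L) by field; rewrite !gt_eqF.
rewrite mulrBl; lra.
Qed.

Lemma regret_intervention_best : exists B0 : R, forall (B : R) (alg : algorithm I),
  B0 <= B -> 2 * gamma I * (M I)%:R + 1 <= B -> crm_nb_alg B alg ->
  regret alg B <= 2 * regret_bound astar B.
Proof.
have d0p : 0 < d0 := gap0.
have g0 : 0 < gamma I := lt_le_trans ltr01 gamma1.
pose D := \sum_(ix : 'I_(M I) * bool | 0 < gap ix) gap ix * rate_ucb istar xstar ix.1 ix.2.
have D0 : 0 <= D.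
  by apply: sumr_ge0 => ix /ltW h; rewrite mulr_ge0 // divr_ge0 ?sqr_ge0.
pose N : R := 2 + 3 * #|{: 'I_(M I) * bool}|%:R.
have N0 : 0 < N by rewrite ltr_wpDr // mulr_ge0.
(* Twice the bound contains 100 / d0 ln B, since the mean gap of observing is at least d0.
   Observations use 32 / d0; the rest is halved: 34 / d0 for the unsettled runs, through [dl], and
   34 / d0 for the constants collected in [A]. *)
pose dl := 34 / d0 / (D + 1).
have dl0 : 0 < dl by rewrite !divr_gt0 // ltr_wpDl.
have Ddl : D * dl <= 34 / d0.
  rewrite /dl mulrCA ler_piMr ?divr_ge0 ?(ltW d0p) //.
  by rewrite ler_pdivrMr ?mul1r ?lerDl // ltr_wpDl.
have [m0 m00 mP] := expR_small (deviation_rate_gt0 pmin0 gap0) (divr_gt0 dl0 N0).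
pose m := Num.max m0 (8 / d0 ^+ 2).
have m8 : 8 / d0 ^+ 2 <= m by rewrite le_max lexx orbT.
have mm : 0 <= m by rewrite le_max m00.
have {mP} mP : N * expR (- (deviation_rate istar xstar * m)) <= dl.
  by rewrite mulrC -ler_pdivlMr //; apply: mP; rewrite le_max lexx.
pose A := v + d0 * ((init_rounds I)%:R + gamma I + 4 + bad_obs_total istar xstar) +
  \sum_(ix : 'I_(M I) * bool | 0 < gap ix)
    gap ix * ((settle_time I m)%:R + 4 + geom_sum ((gap ix / 4) ^+ 2 / 2)).
exists (expR (A * d0 / 34)) => B alg B0 budget crm.
have B1 := B_ge1 gamma1 budget.
have LB := lnB_ge0 gamma1 budget.
have AB : A <= 34 / d0 * ln B.
  rewrite mulrAC ler_pdivlMr // -ler_pdivrMl // mulrC.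
  by rewrite -[X in X <= _]expRK ler_ln ?posrE ?expR_gt0 // (lt_le_trans ltr01).
apply: le_trans (regret_le nobd gamma1 pmin0 budget crm best) _.
rewrite big_option /= mul1r.
have H0 := ler_wpM2l (ltW d0p) (expect_obs_pulls nobd gamma1 pmin0 gap0 budget crm).
have H1 : \sum_(ix : 'I_(M I) * bool) gamma I * value_gap astar (Some ix) *
     expect alg B (fun g => (pulls (Some ix : arm I) g)%:R) (Num.truncn B) [::] <=
  \sum_(ix : 'I_(M I) * bool | 0 < gap ix)
    (gap ix * (rate_net istar xstar ix.1 ix.2 * ln B) +
     gap ix * rate_ucb istar xstar ix.1 ix.2 * (ln B * dl) +
     gap ix * ((settle_time I m)%:R + 4 + geom_sum ((gap ix / 4) ^+ 2 / 2))).
  rewrite [X in _ <= X]big_mkcond; apply: ler_sum => -[i x] _ /=.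
  rewrite -[Some (i, x)]/(do_arm i x) -mean_gapE; case: ifP => gi.
    have := ler_wpM2l (ltW gi) (expect_do_pulls nobd gamma1 pmin0 gap0 budget crm gi m8).
    move=> H; apply: le_trans H _.
    rewrite (_ : forall gp rn ru L d c : R, gp * (rn * L) + gp * ru * (L * d) + gp * c =
      gp * (rn * L + ru * L * d + c)); last by move=> *; ring.
    apply: ler_wpM2l; first exact: ltW.
    rewrite lerD2r lerD2l; apply: ler_wpM2l.
      by rewrite mulr_ge0 // divr_ge0 ?sqr_ge0.
    by apply: le_trans mP; exact: prob_unsettled.
  (* Mean gaps of interventions are non-negative, so the arms left out of the sum have gap 0. *)
  have -> : mean_gap astar (do_arm i x) = 0; last by rewrite mul0r.
  apply/eqP; rewrite eq_le leNgt gi /= mean_gapE mulr_ge0 ?(ltW g0) //.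
  by rewrite subr_ge0 best.
rewrite !big_split /= -mulr_suml -/D in H1.
have DL : D * (ln B * dl) <= 34 / d0 * ln B.
  by rewrite mulrCA mulrC ler_wpM2r.
have d32 : d0 * (32 / d0 ^+ 2 * ln B) = 32 / d0 * ln B by field; rewrite gt_eqF.
rewrite mulrDr d32 in H0.
have F : \sum_(ix : 'I_(M I) * bool | 0 < gap ix) gap ix * (rate_net istar xstar ix.1 ix.2 * ln B) +
   100 / d0 * ln B <= 2 * regret_bound astar B.
  rewrite /regret_bound mulrDr; apply: lerD.
    rewrite mulr_sumr; apply: ler_sum => -[i x] /= gi.
    rewrite [X in _ <= X]mulrCA ler_wpM2l ?(ltW gi) // mulrDr.
    apply: le_trans (rate_net_le LB gi) _; by rewrite lerDl mulr_ge0 // divr_ge0 // sqr_ge0.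
  have h : 50 * ln B / d0 ^+ 2 <= 50 * ln B / d0 ^+ 2 + 1 + pi ^+ 2 / 3.
    by rewrite -addrA lerDl addr_ge0 // divr_ge0 // sqr_ge0.
  have h0 : 0 <= 50 * ln B / d0 ^+ 2 by rewrite divr_ge0 ?sqr_ge0 // mulr_ge0.
  have := ler_pM (ltW d0p) h0 obs_gap_le h.
  have -> : d0 * (50 * ln B / d0 ^+ 2) = 50 / d0 * ln B by field; rewrite gt_eqF.
  have -> : 100 / d0 * ln B = 2 * (50 / d0 * ln B) by field; rewrite gt_eqF.
  by move=> H; rewrite ler_wpM2l.
apply: le_trans F.
have -> : 100 / d0 * ln B = 32 / d0 * ln B + 34 / d0 * ln B + 34 / d0 * ln B by field; rewrite gt_eqF.
rewrite /A in AB; rewrite -/obs_arm; lra.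
Qed.

End InterventionBest.

(** * Observing is the best arm *)

Lemma ln_le_sqrt (R : realType) (x : R) : 0 < x -> ln x <= 2 * Num.sqrt x.
Proof.
move=> x0; have s0 : 0 < Num.sqrt x by rewrite sqrtr_gt0.
rewrite -{1}(sqr_sqrtr (ltW x0)) lnXn // -[X in X <= _]mulr_natl ler_wpM2l //.
exact: ltW (ln_sublinear s0).
Qed.

Section ObservationBest.
Context (R : realType) (I : causal_bandit R).
Implicit Types (h g : history I) (a b : arm I) (n : nat) (r : round I) (i : 'I_(M I)) (x : bool).
Hypothesis nobd : no_backdoor I.
Hypothesis gamma1 : 1 <= gamma I.
Hypothesis pmin0 : 0 < prob_min I.
Hypothesis best : forall b : arm I, value b <= value (obs_arm : arm I).
Local Notation mu0 := (mu (obs_arm : arm I)).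
Local Notation interv := ('I_(M I) * bool)%type.

(** The radius has a fixed L instead of the logarithm of the current time: one event serves all
    times s <= t with L <= ln s. The margin between this 6 and the 8 of the index is exploited in
    [radius_ratio]. *)
Definition misled (L : R) (t : nat) : pred (history I) :=
  predU
  (fun h => has (fun k => undershoots (informative obs_arm) (@rewarded R I) mu0
     (scale 6 L k) k.+1%:R h) (iota 0 t))
  (fun h => has (fun ix : interv => has (fun k =>
     overshoots (informative (do_arm ix.1 ix.2)) (@rewarded R I)
     (mu (do_arm ix.1 ix.2)) (scale 6 L k) k.+1%:R h) (iota 0 t)) (enum {: interv})).

Lemma misled_obs L t h alg B : reach alg B h -> ~~ misled L t h -> (size h <= t)%N ->
  0 <= L <= ln (size h)%:R -> (0 < samples obs_arm h)%N ->
  mu0 - Num.sqrt (6 * ln (size h)%:R / (samples obs_arm h)%:R) < mu_hat obs_arm h.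
Proof.
move=> rh + sz /andP[L0 LE] s0; rewrite /misled /= negb_or => /andP[/hasPn H _].
rewrite ltNge; apply/negP => U.
have /H : (samples obs_arm h).-1 \in iota 0 t.
  by rewrite mem_iota /= add0n prednK // (leq_trans (samples_le_size _ _)).
move=> /negP[]; apply: (mu_hat_under rh) => //; first by rewrite prednK.
apply: le_trans U _; rewrite lerD2l lerN2 /scale prednK // ler_sqrt.
  by rewrite ler_pM2r ?invr_gt0 ?ltr0n // ler_wpM2l.
by rewrite divr_ge0 // mulr_ge0 // (le_trans L0).
Qed.

Lemma misled_do L t h alg B i x : reach alg B h -> ~~ misled L t h -> (size h <= t)%N ->
  0 <= L <= ln (size h)%:R -> (0 < samples (do_arm i x) h)%N ->
  mu_hat (do_arm i x) h < mu (do_arm i x) + Num.sqrt (6 * ln (size h)%:R / (samples (do_arm i x) h)%:R).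
Proof.
move=> rh + sz /andP[L0 LE] s0; rewrite /misled /= negb_or => /andP[_ /hasPn H].
rewrite ltNge; apply/negP => U.
have /H/hasPn : (i, x) \in enum {: interv} by rewrite mem_enum.
have K : (samples (do_arm i x) h).-1 \in iota 0 t.
  by rewrite mem_iota /= add0n prednK // (leq_trans (samples_le_size _ _)).
move=> /(_ _ K) /negP[]; apply: (mu_hat_over rh) => //=; first by rewrite prednK.
apply: le_trans U; rewrite lerD2l /scale prednK // ler_sqrt.
  by rewrite ler_pM2r ?invr_gt0 ?ltr0n // ler_wpM2l.
by rewrite divr_ge0 // mulr_ge0 // (le_trans L0).
Qed.

(** Equivalent to sqrt 8 + sqrt 6 <= 15 (sqrt 8 - sqrt 6). *)
Lemma sqrt68_le : 8 * Num.sqrt 6 <= 7 * Num.sqrt 8 :> R.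
Proof.
rewrite -(@ler_pXn2r _ 2) ?nnegrE ?mulr_ge0 ?sqrtr_ge0 // !exprMn !sqr_sqrtr //; lra.
Qed.

(* 225 = 15^2, and the ratio of sqrt 8 + sqrt 6 to sqrt 8 - sqrt 6 is at most
   15: 8 comes from the index, 6 is the largest deviation outside misled. *)
Lemma radius_ratio (u s e : R) : 0 <= u -> 0 < s -> 0 < e ->
  Num.sqrt (8 * u / s) - Num.sqrt (6 * u / s) < Num.sqrt (8 * u / e) + Num.sqrt (6 * u / e) ->
  e <= 225 * s.
Proof.
move=> u0 s0 e0; rewrite leNgt => H; apply/negP => es; move: H.
have sE c q : 0 <= c -> Num.sqrt (c * u / q) = Num.sqrt c * Num.sqrt (u / q).
  by move=> c0; rewrite -mulrA sqrtrM.
rewrite !sE //.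
have zx : Num.sqrt (u / e) <= Num.sqrt (u / s) / 15.
  have -> : Num.sqrt (u / s) / 15 = Num.sqrt (u / (225 * s)).
    have -> : u / (225 * s) = (1 / 15) ^+ 2 * (u / s) by field; rewrite gt_eqF.
    by rewrite [RHS]sqrtrM ?sqr_ge0 // sqrtr_sqr ger0_norm ?divr_ge0 // mulrC mul1r.
  rewrite ler_sqrt; last by rewrite divr_ge0 // mulr_ge0 // ltW.
  by rewrite ler_wpM2l // lef_pV2 ?posrE ?mulr_gt0 // ltW.
have x0 : 0 <= Num.sqrt (u / s) := sqrtr_ge0 _.
move: zx x0; move: (Num.sqrt (u / e)) (Num.sqrt (u / s)) => z x zx x0.
have s6 : 0 <= Num.sqrt 6 :> R := sqrtr_ge0 _.
have s8 : 0 <= Num.sqrt 8 :> R := sqrtr_ge0 _.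
apply/negP; rewrite -leNgt.
have h1 := ler_wpM2r x0 sqrt68_le.
have h2 := ler_wpM2l (addr_ge0 s8 s6) zx.
lra.
Qed.

Variables (alg : algorithm I) (B : R).
Hypothesis budget : 2 * gamma I * (M I)%:R + 1 <= B.
Hypothesis crm : crm_nb_alg B alg.
Local Notation reach := (reach alg B).
Local Notation horizon := (Num.truncn B).

Lemma prob_misled n L t : 0 <= L -> prob_hit alg B n (misled L t) <=
  (init_rounds I)%:R * (t%:R * expR (- (3 * L))).
Proof.
move=> L0; set e := t%:R * _; apply: le_trans (prob_hitU _ _ _ _ _) _.
have E : expR (- (6 * L / 2)) = expR (- (3 * L)) by congr expR; field.
have cst (F : nat -> R) : (forall k, F k <= expR (- (3 * L))) -> \sum_(k <- iota 0 t) F k <= e.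
  move=> Fk; apply: le_trans (ler_sum _ (fun k _ => Fk k)) _.
  by rewrite big_const_seq count_predT size_iota iter_addr addr0 -[X in X <= _]mulr_natl.
have -> : (init_rounds I)%:R * e = e + \sum_(ix : interv) e.
  rewrite sumr_const -[X in _ + X]mulr_natl card_prod card_ord card_bool /init_rounds natrD natrM natrM; ring.
apply: lerD.
  apply: le_trans (prob_hit_has _ _ _ _ _) _; apply: cst => k; rewrite -E.
  by apply: prob_scale_under; rewrite ?mulr_ge0 //; exact: calibrated_reward.
apply: le_trans (prob_hit_has _ _ _ _ _) _; rewrite big_enum /=; apply: ler_sum => ix _.
apply: le_trans (prob_hit_has _ _ _ _ _) _; apply: cst => k; rewrite -E.
by apply: prob_scale_over; rewrite ?mulr_ge0 //; exact: calibrated_reward.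
Qed.

Lemma ucb_obs_ge L t h : reach h -> ~~ misled L t h -> (size h <= t)%N ->
  (init_rounds I <= size h)%N -> 0 <= L <= ln (size h)%:R ->
  mu0 + (Num.sqrt (8 * ln (size h)%:R / (samples obs_arm h)%:R) -
         Num.sqrt (6 * ln (size h)%:R / (samples obs_arm h)%:R)) < ucb obs_arm h.
Proof.
move=> rh nm st sz LL; have := misled_obs rh nm st LL (samples_gt0 crm _ rh sz).
by rewrite /ucb divr1; lra.
Qed.

(** As mu_{i,x} <= gamma mu_0, an intervention whose index reaches that of observing must make up
    the surplus of the latter over mu_0 by its own radius and deviation, even in case of a tie. *)
Lemma do_samples_le L t h i x : reach h -> ~~ misled L t h -> (size h <= t)%N ->
  (init_rounds I <= size h)%N -> 0 <= L <= ln (size h)%:R ->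
  ucb obs_arm h <= ucb (do_arm i x) h ->
  (samples (do_arm i x) h)%:R <= 225 * (samples obs_arm h)%:R :> R.
Proof.
move=> rh nm st sz LL U.
have s0 a := samples_gt0 crm a rh sz.
have g0 : 0 < gamma I := lt_le_trans ltr01 gamma1.
apply: (@radius_ratio (ln (size h)%:R)); rewrite ?ltr0n ?ln_ge0_nat //.
have := misled_do rh nm st LL (s0 (do_arm i x)).
have := lt_le_trans (ucb_obs_ge rh nm st sz LL) U.
rewrite {1}/ucb (_ : cost (do_arm i x) = gamma I) // ltr_pdivlMr //.
have := best (do_arm i x); rewrite value_obs /value (_ : cost (do_arm i x) = gamma I) // ler_pdivrMr //.
set S8 := Num.sqrt (8 * _ / (samples obs_arm h)%:R); set S6 := Num.sqrt (6 * _ / (samples obs_arm h)%:R).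
set Z8 := Num.sqrt (8 * _ / (samples (do_arm i x) h)%:R); set Z6 := Num.sqrt (6 * _ / (samples (do_arm i x) h)%:R).
have S0 : 0 <= S8 - S6.
  rewrite subr_ge0 ler_sqrt ?divr_ge0 ?mulr_ge0 ?ln_ge0_nat //.
  by rewrite ler_pM2r ?invr_gt0 ?ltr0n // ler_wpM2r ?ln_ge0_nat // ler_nat.
have := ler_wpM2l S0 gamma1; rewrite mulr1.
rewrite mulrDl; lra.
Qed.

(* Ties between interventions and observation are allowed, so that only a
   comparison with the best index keeps the observations frequent. *)
Lemma do_pulls_le L t g (T0 : R) i x : reach g -> ~~ hit (misled L t) g -> (size g <= t)%N ->
  (init_rounds I)%:R <= T0 -> 0 <= L -> expR L <= T0 ->
  (pulls (do_arm i x) g)%:R <= 225 * (pulls obs_arm g)%:R + 1 + T0.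
Proof.
move=> rg; elim: rg => [|h a w rh IH Ea ca] nh st iT L0 LT.
  by rewrite /= addr_ge0 ?addr_ge0 ?mulr_ge0 // (le_trans _ iT).
move: nh; rewrite hit_cons negb_or => /andP[_ nh].
have {}IH := IH nh (ltnW st) iT L0 LT.
have [ai|ai] := eqVneq a (do_arm i x); last first.
  rewrite /= (negPf ai) add0n; apply: le_trans IH _.
  by rewrite !lerD2r ler_wpM2l // ler_nat leq_addl.
have [sT|sT] := ltP (size h)%:R T0.
  apply: le_trans (_ : (size (observe a w :: h))%:R <= _); first by rewrite ler_nat count_size.
  rewrite /= -natr1; have : 0 <= 225 * (pulls obs_arm (observe a w :: h))%:R :> R by rewrite mulr_ge0.
  by rewrite /=; lra.
have sz : (init_rounds I <= size h)%N by rewrite -(ler_nat R) (le_trans iT).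
case: (stepP crm Ea) => [|_ a0|_ a0|_ _ U]; first by rewrite ltnNge sz.
- by move: ai; rewrite a0 /obs_arm /do_arm.
- by move: ai; rewrite a0 /obs_arm /do_arm.
have nm : ~~ misled L t h by apply: contra nh; exact: hit_self.
have LL : 0 <= L <= ln (size h)%:R.
  rewrite L0 -[X in X <= _]expRK ler_ln ?posrE ?expR_gt0 ?(le_trans LT) //.
  by rewrite ltr0n; apply: leq_trans sz; rewrite /init_rounds addn1.
have := U obs_arm; rewrite ai => /(do_samples_le rh nm (ltnW st) sz LL).
rewrite samples_obs /= eqxx add1n -natr1 => H.
have h1 : (pulls (do_arm i x) h)%:R <= (samples (do_arm i x) h)%:R :> R by rewrite ler_nat pulls_samples.
have : 0 <= T0 by rewrite (le_trans _ iT).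
by rewrite add0n; lra.
Qed.

Lemma sum_all_pulls h : (size h)%:R = (pulls obs_arm h)%:R +
  \sum_(ix : interv) (pulls (do_arm ix.1 ix.2) h)%:R :> R.
Proof.
have := sum_pulls (fun _ => 1 : R) h; rewrite big_option.
rewrite big_const_seq count_predT iter_addr addr0 mul1r => ->; congr (_ + _).
by apply: eq_bigr => -[i x] _; rewrite mul1r.
Qed.

Local Notation Mr := ((M I)%:R : R).
(** With N observations, summing [do_pulls_le] over the 2M interventions with T0 = t / (8M) gives t
    <= (1 + 450M) N + 2M + t / 4, hence t / 2 <= (1 + 450M) N once t >= 8M. [log_time] is ln T0. *)
Definition obs_fraction : R := (2 + 900 * Mr)^-1.
Definition log_time (t : nat) : R := ln (t%:R / (8 * Mr)).

Lemma Mr_ge1 : 1 <= Mr.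
Proof. by rewrite ler1n M_gt0. Qed.

Lemma obs_linear h : reach h -> ~~ hit (misled (log_time (size h)) (size h)) h ->
  (8 * M I * init_rounds I <= size h)%N -> obs_fraction * (size h)%:R <= (pulls obs_arm h)%:R.
Proof.
move=> rh nh sz; have M1 := Mr_ge1; set t : R := (size h)%:R.
have tM : 8 * Mr * (init_rounds I)%:R <= t by rewrite -!natrM ler_nat.
have i3 : 3 <= (init_rounds I)%:R :> R by rewrite ler_nat (init_ge3 I).
have M8 : 0 < 8 * Mr by rewrite mulr_gt0 // (lt_le_trans ltr01).
have iT : (init_rounds I)%:R <= t / (8 * Mr) by rewrite ler_pdivlMr // mulrC.
have T1 : 1 <= t / (8 * Mr) by lra.
have L0 : 0 <= log_time (size h) by exact: ln_ge0.
have eL : expR (log_time (size h)) <= t / (8 * Mr) by rewrite lnK // posrE; lra.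
have E : t = _ := sum_all_pulls h.
have H : t <= (pulls obs_arm h)%:R + \sum_(ix : interv) (225 * (pulls obs_arm h)%:R + 1 + t / (8 * Mr)).
  rewrite {1}E lerD2l; apply: ler_sum => -[i x] _.
  exact: (do_pulls_le i x rh nh (leqnn _) iT L0 eL).
move: H; rewrite sumr_const -[X in _ <= _ + X]mulr_natl card_prod card_ord card_bool natrM.
have -> : Mr * 2 * (225 * (pulls obs_arm h)%:R + 1 + t / (8 * Mr)) =
  450 * Mr * (pulls obs_arm h)%:R + 2 * Mr + t / 4 by field; rewrite gt_eqF //; lra.
move=> H; rewrite /obs_fraction mulrC ler_pdivrMr; last by lra.
have : 8 * Mr <= t by apply: le_trans tM; rewrite ler_peMr // ?ltW //; lra.
lra.
Qed.

Lemma hit_hit (Q : pred (history I)) h : hit (hit Q) h -> hit Q h.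
Proof.
elim: h => [|r h IH]; first by rewrite /hit /= !orbF.
by rewrite hit_cons => /orP[//|/IH H]; rewrite hit_cons H orbT.
Qed.

Variables (j : 'I_(M I)) (y : bool).
Local Notation b := (do_arm j y).
Local Notation w := (gamma I * value_gap obs_arm b).
Local Notation p := (prob j y).
Hypothesis gapb : 0 < value_gap obs_arm b.

Definition do_fraction : R := p / 2 * obs_fraction.
(** The first summand is what [obs_linear] asks for; the second gives 8 ln t <= 16 sqrt t <= (w /
    2)^2 [do_fraction] t, so that the radius of b is at most w / 2. *)
Definition late_time : nat :=
  (8 * M I * init_rounds I + (Num.truncn ((16 / ((w / 2) ^+ 2 * do_fraction)) ^+ 2)).+1)%N.

(** [hit] occurs inside the event because [obs_linear] relies on all earlier rounds. *)
Definition late_error (t : nat) : pred (history I) :=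
  if (t < late_time)%N then pred0 else
  predU (hit (misled (log_time t) t))
  (predU (undershoots (@obs_round R I) (obs_value j y) p (p / 2) (obs_fraction * t%:R))
   (overshoots (informative b) (@rewarded R I) (mu b) (w / 2) (do_fraction * t%:R))).

Definition late_error_total : R :=
  (init_rounds I)%:R * (8 * Mr) ^+ 3 * 2 +
  geom_sum ((p / 2) ^+ 2 / 2 * obs_fraction) + geom_sum ((w / 2) ^+ 2 / 2 * do_fraction).

Lemma obs_fraction_gt0 : 0 < obs_fraction.
Proof. by have := Mr_ge1; rewrite invr_gt0; lra. Qed.

Lemma do_fraction_gt0 : 0 < do_fraction.
Proof. by rewrite mulr_gt0 ?obs_fraction_gt0 // divr_gt0 // prob_gt0. Qed.

Lemma w_gt0 : 0 < w.
Proof. by rewrite mulr_gt0 // (lt_le_trans ltr01). Qed.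

Lemma late_time_ge : (8 * M I * init_rounds I <= late_time)%N.
Proof. exact: leq_addr. Qed.

Lemma prob_late_error n t : prob_hit alg B n (late_error t) <=
  (init_rounds I)%:R * (8 * Mr) ^+ 3 * (t%:R ^+ 2)^-1 +
  expR (- ((p / 2) ^+ 2 / 2 * obs_fraction * t%:R)) +
  expR (- ((w / 2) ^+ 2 / 2 * do_fraction * t%:R)).
Proof.
have M1 := Mr_ge1; have M8 : 0 < 8 * Mr by lra.
rewrite /late_error; case: ltnP => tl.
  rewrite prob_hit_pred0 !addr_ge0 ?expR_ge0 // mulr_ge0 ?invr_ge0 ?sqr_ge0 //.
  by rewrite mulr_ge0 // exprn_ge0 // ltW.
have tM : 8 * Mr <= t%:R.
  rewrite -natrM ler_nat; apply: leq_trans tl; apply: leq_trans late_time_ge.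
  by rewrite leq_pmulr // /init_rounds addn1.
have t0 : 0 < t%:R :> R by exact: lt_le_trans tM.
have w0 := w_gt0; have pp := prob_gt0 pmin0 j y.
apply: le_trans (prob_hitU _ _ _ _ _) _; rewrite -addrA; apply: lerD.
  apply: le_trans (_ : prob_hit alg B n (misled (log_time t) t) <= _).
    apply: expect_le' => g _; have := @hit_hit (misled (log_time t) t) g.
    by case: (hit (hit _) g) => [->//|_]; rewrite ler0n.
  have T1 : 1 <= t%:R / (8 * Mr) by rewrite ler_pdivlMr // mul1r.
  apply: le_trans (prob_misled _ _ (ln_ge0 T1)) _.
  rewrite -[X in _ <= X]mulrA ler_wpM2l //.
  (* t exp (- 3 ln (t / (8M))) = (8M)^3 / t^2, which is summable. *)
  have -> : 3 * log_time t = ln ((t%:R / (8 * Mr)) ^+ 3).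
    by rewrite lnXn ?divr_gt0 // -[RHS]mulr_natl.
  rewrite expRN lnK ?posrE ?exprn_gt0 ?divr_gt0 //.
  by rewrite le_eqVlt; apply/orP; left; apply/eqP; field; rewrite !gt_eqF //; lra.
apply: le_trans (prob_hitU _ _ _ _ _) _; apply: lerD.
  apply: le_trans (prob_under _ _ _ _ (calibrated_value pmin0 _ _) _) _; first by rewrite divr_ge0 // ltW.
  by rewrite ler_expR lerN2 le_eqVlt; apply/orP; left; apply/eqP; ring.
apply: le_trans (prob_over _ _ _ _ (calibrated_reward nobd pmin0 _) _) _; first by rewrite divr_ge0 // ltW.
by rewrite ler_expR lerN2 le_eqVlt; apply/orP; left; apply/eqP; ring.
Qed.

(** A late b has a number of samples linear in t and radius at most w / 2, so its index reaches mu_0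
    only if its mean is overestimated by w / 2. *)
Lemma late_step h a : reach h -> alg h = Some a -> a == b ->
  ((size h < late_time)%N || late_error (size h) h).
Proof.
move=> rh Ea /eqP ab; rewrite ab in Ea; rewrite /late_error; case: ltnP => //= tl.
have sz8 := leq_trans late_time_ge tl.
have sz : (init_rounds I <= size h)%N.
  by apply: leq_trans sz8; rewrite leq_pmull // muln_gt0 /= M_gt0.
case: (stepP crm Ea) => [|//|//|_ _ U]; first by rewrite ltnNge sz.
have M1 := Mr_ge1; have w0 := w_gt0; have pp := prob_gt0 pmin0 j y.
have of0 := obs_fraction_gt0; have df0 := do_fraction_gt0.
have [//|nm] := boolP (hit (misled (log_time (size h)) (size h)) h).
have nm' : ~~ misled (log_time (size h)) (size h) h by apply: contra nm; exact: hit_self.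
have N0 := obs_linear rh nm sz8.
have tM : 8 * Mr <= (size h)%:R.
  rewrite -natrM ler_nat; apply: leq_trans sz8.
  by rewrite leq_pmulr // /init_rounds addn1.
set t : R := (size h)%:R in N0 tM *.
have t0 : 0 < t by apply: lt_le_trans tM; lra.
have LL : 0 <= log_time (size h) <= ln t.
  rewrite /log_time ln_ge0 ?ler_pdivlMr ?mul1r //=; last by lra.
  by rewrite ler_ln ?posrE ?divr_gt0 //; [rewrite ler_pdivrMr ?ler_peMr ?(ltW t0) //; lra|lra].
rewrite /=; have [//|/negPf nF] := boolP (undershoots _ _ _ _ _ h).
have s0 := samples_gt0 crm b rh sz.
have Eb : do_fraction * t <= (samples b h)%:R.
  apply: le_trans (_ : (count (predI (@obs_round R I) (obs_value j y)) h)%:R <= _); last first.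
    by rewrite ler_nat samples_do leq_addl.
  move/negbT: nF; rewrite /undershoots -pulls_obsE N0 /= -ltNge => /ltW; apply: le_trans.
  rewrite /do_fraction -mulrA; apply: le_trans (ler_wpM2l _ N0) _; first by rewrite divr_ge0 // ltW.
  by rewrite ler_wpM2r //; lra.
apply: (mu_hat_over rh) => //.
have := lt_le_trans (ucb_obs_ge rh nm' (leqnn _) sz LL) (U obs_arm).
rewrite {1}/ucb (_ : cost b = gamma I) // ltr_pdivlMr; last exact: lt_le_trans gamma1.
have S0 : 0 <= Num.sqrt (8 * ln t / (samples obs_arm h)%:R) - Num.sqrt (6 * ln t / (samples obs_arm h)%:R).
  rewrite subr_ge0 ler_sqrt ?divr_ge0 ?mulr_ge0 ?ln_ge0_nat //.
  rewrite ler_pM2r ?invr_gt0 ?ltr0n ?(samples_gt0 crm) //.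
  by rewrite ler_wpM2r ?ln_ge0_nat // ler_nat.
have : Num.sqrt (8 * ln t / (samples b h)%:R) <= w / 2.
  have w2 : 0 < w / 2 by rewrite divr_gt0.
  rewrite -[X in _ <= X](gtr0_norm w2) -sqrtr_sqr ler_sqrt ?sqr_ge0 //.
  rewrite ler_pdivrMr ?ltr0n //; apply: le_trans (ler_wpM2l (sqr_ge0 _) Eb).
  have e0 : 0 < (w / 2) ^+ 2 * do_fraction by rewrite mulr_gt0 // exprn_gt0.
  rewrite mulrA; move: e0 tl; rewrite /late_time; move: (_ * do_fraction) => e e0 tl.
  have te : (16 / e) ^+ 2 <= t.
    have q0 : 0 <= (16 / e) ^+ 2 := sqr_ge0 _.
    by apply: ltW; rewrite -truncn_lt_nat //; apply: leq_trans tl; rewrite leq_addl.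
  have st : 16 / e <= Num.sqrt t.
    by rewrite -[X in X <= _](@gtr0_norm _ (16 / e)) ?divr_gt0 // -sqrtr_sqr ler_sqrt //.
  apply: le_trans (ler_wpM2l _ (ln_le_sqrt t0)) _ => //.
  rewrite -[t in X in _ <= X](sqr_sqrtr (ltW t0)) expr2.
  have st0 := sqrtr_ge0 t; have := ler_wpM2r st0 (ler_wpM2l (ltW e0) st).
  have -> : e * (16 / e) = 16 by field; rewrite gt_eqF.
  lra.
have := mulr_ge0 S0 (le_trans ler01 gamma1).
have -> : w = gamma I * mu0 - mu b.
  by rewrite /value_gap mulrBr value_obs [X in _ - X = _]mulrC -(muE gamma1).
set S := _ - _; lra.
Qed.

Lemma expect_do_pulls_late :
  expect alg B (fun g => (pulls b g)%:R) horizon [::] <= late_time%:R + 1 + late_error_total.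
Proof.
pose P1 a g := (a == b :> arm I) && ((size g)%:R < late_time%:R :> R).
pose P2 a g := (a == b :> arm I) && late_error (size g) g.
apply: le_trans (_ : expect alg B (fun g => (late_time%:R + 1) + (steps P2 g)%:R) horizon [::] <= _).
  apply: expect_le' => g rg.
  have H : (pulls b g <= steps P1 g + steps P2 g)%N.
    rewrite pulls_steps; apply: leq_trans (stepsU _ _ _); apply: (steps_le rg) => a h rh Ea _ ab.
    by have := late_step rh Ea ab; rewrite /P1 /P2 ab /= ltr_nat.
  have H1 : (steps P1 g)%:R <= late_time%:R + 1 :> R.
    by apply: (steps_lt_bound g (indexing_size _)).
  have : (pulls b g)%:R <= (steps P1 g)%:R + (steps P2 g)%:R :> R by rewrite -natrD ler_nat.
  lra.
rewrite expectD expect_cst lerD2l.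
have := @expect_steps R I gamma1 alg B budget (fun a _ => a == b) (fun g => size g) late_error (indexing_size _) (fun _ _ => leqnn _).
move=> H; apply: le_trans H _.
apply: le_trans (ler_sum _ (fun k _ => prob_late_error _ _)) _.
rewrite !big_split /= -mulr_sumr /late_error_total.
have of0 := obs_fraction_gt0; have df0 := do_fraction_gt0; have w0 := w_gt0; have pp := prob_gt0 pmin0 j y.
apply: lerD; first apply: lerD.
- apply: ler_wpM2l; last exact: sum_inv_sqr_le.
  by rewrite mulr_ge0 // exprn_ge0 // mulr_ge0.
- by apply: sum_expR_le; rewrite mulr_gt0 // divr_gt0 // exprn_gt0 // divr_gt0.
- by apply: sum_expR_le; rewrite mulr_gt0 // divr_gt0 // exprn_gt0 // divr_gt0.
Qed.

End ObservationBest.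

Lemma regret_observation_best (R : realType) (I : causal_bandit R) :
  no_backdoor I -> 1 <= gamma I -> 0 < prob_min I ->
  (forall b : arm I, value b <= value (obs_arm : arm I)) ->
  exists K : R, forall (B : R) (alg : algorithm I),
    2 * gamma I * (M I)%:R + 1 <= B -> crm_nb_alg B alg -> regret alg B <= K.
Proof.
move=> nobd gamma1 pmin0 best.
exists (value (obs_arm : arm I) + \sum_(ix : 'I_(M I) * bool)
  gamma I * value_gap obs_arm (do_arm ix.1 ix.2) *
    ((late_time ix.1 ix.2)%:R + 1 + late_error_total ix.1 ix.2)) => B alg budget crm.
apply: le_trans (regret_le nobd gamma1 pmin0 budget crm best) _.
rewrite lerD2l big_option (subrr _ : value_gap obs_arm None = 0) mulr0 mul0r add0r.
apply: ler_sum => -[i x] _; have g0 : 0 <= gamma I := le_trans ler01 gamma1.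
rewrite -[Some (i, x)]/(do_arm i x) (_ : cost (do_arm i x) = gamma I) //.
have : 0 <= value_gap obs_arm (do_arm i x) by rewrite subr_ge0 best.
(* A tied intervention causes no regret, however often it is pulled. *)
rewrite le_eqVlt => /predU1P[<-|gap]; first by rewrite mulr0 !mul0r.
apply: ler_wpM2l; first by rewrite mulr_ge0 // ltW.
exact: (expect_do_pulls_late nobd gamma1 pmin0 best budget crm gap).
Qed.

Theorem theorem3 (R : realType) :
  (forall I : causal_bandit R,
     no_backdoor I -> 1 <= gamma I -> 0 < prob_min I ->
     best_arm (obs_arm : arm I) ->
     exists K : R, forall (B : R) (alg : algorithm I),
       2 * gamma I * (M I)%:R + 1 <= B -> crm_nb_alg B alg ->
       regret alg B <= K)
  /\
  (exists2 C : R, 0 < C &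
     forall (I : causal_bandit R) (astar : arm I),
       no_backdoor I -> 1 <= gamma I -> 0 < prob_min I ->
       best_arm astar -> astar <> obs_arm ->
       exists B0 : R, forall (B : R) (alg : algorithm I),
         B0 <= B -> 2 * gamma I * (M I)%:R + 1 <= B -> crm_nb_alg B alg ->
         regret alg B <= C * regret_bound astar B).
Proof.
split=> [I nobd gamma1 pmin0 [best _]|]; first exact: regret_observation_best.
exists 2 => // I [[i x]|//] nobd gamma1 pmin0 [best tie] aN.
apply: (regret_intervention_best nobd gamma1 pmin0 best).
(* The tie rule makes the gap of observing strict: otherwise observing would be best too and [astar]
   would be [obs_arm]. *)
rewrite subr_gt0 ltNge; apply/negP => obs_best; apply: aN; apply: tie => b.
exact: le_trans (best b) obs_best.
Qed.
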